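(* Let $H\in(1/2,1)$, $\alpha\in(1-H,1/2)$, $\beta\in(1/2,H)$, let $B^H$ be a fractional Brownian motion with Hurst parameter $H$, let $a,b:\mathbb{R}\to\mathbb{R}$ satisfy assumptions (A), (B), (C) listed in the context with constants $\delta,K,L,(R_N)_{N\ge1}$, and let $X$ be the solution of $$X_t=X_0+\int_0^t a(X_s)\,ds+\int_0^t b(X_s)\,dB^H_s,\quad t\ge 0,$$ with non-random $X_0$. Then there exists a (deterministic) constant $M_{\alpha,\beta}$ depending on $\alpha$, $\beta$, $K$ and $L$ such that, almost surely, for any $t_1\ge0$ and $t_2\in(t_1,t_1+1]$, $$ |X_{t_2}-X_{t_1}|\le M_{\alpha,\beta}\left(\Lambda_\beta(t_1,t_2)\,(t_2-t_1)^{\beta}+\Lambda_\beta(t_1,t_2)^{1/\beta}\,(t_2-t_1)\right). $$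
   Context: A fractional Brownian motion with Hurst parameter $H$ is a centered Gaussian process $\{B^H_t,t\ge0\}$ with covariance $\mathsf{E}[B^H_tB^H_s]=\frac12(s^{2H}+t^{2H}-|t-s|^{2H})$, with (locally Hölder) continuous paths, on a complete probability space. Assumptions on coefficients: there exist constants $\delta\in(1/H-1,1]$, $K>0$, $L>0$ and for every $N\ge1$ a constant $R_N>0$ such that (A) $|a(x)|+|b(x)|\le K$ for all $x\in\mathbb{R}$; (B) $|a(x)-a(y)|+|b(x)-b(y)|\le L|x-y|$ for all $x,y\in\mathbb{R}$; (C) $b$ is differentiable and $|b'(x)-b'(y)|\le R_N|x-y|^{\delta}$ for all $x,y\in[-N,N]$. Under these assumptions the equation is known to have a unique solution; its paths are almost surely locally Hölder continuous of every order less than $H$. Integrals with respect to $B^H$ are generalized Lebesgue–Stieltjes integrals: for $a_0<b_0$, $$\int_{a_0}^{b_0} f(x)\,dg(x)=e^{i\pi\alpha}\int_{a_0}^{b_0}\big(D^{\alpha}_{a_0+}f\big)(x)\big(D^{1-\alpha}_{b_0-}g_{b_0-}\big)(x)\,dx,\qquad g_{b_0-}(x)=g(x)-g(b_0),$$ provided $D^\alpha_{a_0+}f\in L_1[a_0,b_0]$ and $D^{1-\alpha}_{b_0-}g_{b_0-}\in L_\infty[a_0,b_0]$, where $$\big(D_{a_0+}^{\alpha}f\big)(x)=\frac{1}{\Gamma(1-\alpha)}\bigg(\frac{f(x)}{(x-a_0)^\alpha}+\alpha\int_{a_0}^x\frac{f(x)-f(u)}{(x-u)^{1+\alpha}}du\bigg),$$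 $$\big(D_{b_0-}^{1-\alpha}g\big)(x)=\frac{e^{-i\pi\alpha}}{\Gamma(\alpha)}\bigg(\frac{g(x)}{(b_0-x)^{1-\alpha}}+(1-\alpha)\int_{x}^{b_0}\frac{g(x)-g(u)}{(u-x)^{2-\alpha}}du\bigg).$$ For $u<v$ put $Z(u,v)=\left(D^{1-\alpha}_{v-}B^H_{v-}\right)(u)$ (with $B^H_{v-}(x)=B^H_x-B^H_v$), and for $t_1<t_2$ $$\Lambda_\beta(t_1,t_2)=1\vee\sup_{t_1\le u<v\le t_2}\frac{|Z(u,v)|}{(v-u)^{\beta+\alpha-1}}.$$ *)

(* Defs.v *)
From HB Require Import structures.
From mathcomp Require Import all_boot all_order all_algebra.
From mathcomp Require Import all_classical all_reals all_analysis.
From mathcomp.real_closed Require Import complex.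

Set Implicit Arguments.
Unset Strict Implicit.
Unset Printing Implicit Defensive.

Import Order.TTheory GRing.Theory Num.Theory.
Import numFieldNormedType.Exports.

Local Open Scope classical_set_scope.
Local Open Scope ring_scope.
Local Open Scope complex_scope.

Definition Gamma {R : realType} (z : R) : R :=
  \int[@lebesgue_measure R]_(x in `]0, +oo[) (x `^ (z - 1) * expR (- x)).

(* exp (i theta) *)
Definition expi {R : realType} (theta : R) : R[i] := cos theta +i* sin theta.

Definition Cintegral {R : realType} (D : set R) (f : R -> R[i]) : R[i] :=
  (\int[@lebesgue_measure R]_(x in D) complex.Re (f x)) +i*
  (\int[@lebesgue_measure R]_(x in D) complex.Im (f x)).

(* D^alpha_{a0+} f and D^{1-alpha}_{b0-} g.  The parameter of [right_deriv] is
   alpha, while the order of differentiation is 1 - alpha.  [left_kernel] and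
   [right_kernel] are the integrands of the inner integrals: where these are
   not integrable the derivative does not exist and the value below is junk. *)
Definition left_kernel {R : realType} (alpha : R) (f : R -> R) (x u : R) : R :=
  (f x - f u) / (x - u) `^ (1 + alpha).

Definition left_deriv {R : realType} (alpha a0 : R) (f : R -> R) (x : R) : R :=
  (Gamma (1 - alpha))^-1 *
  (f x / (x - a0) `^ alpha +
   alpha * \int[@lebesgue_measure R]_(u in `[a0, x]) left_kernel alpha f x u).

Definition right_kernel {R : realType} (alpha : R) (g : R -> R) (x u : R) : R :=
  (g x - g u) / (u - x) `^ (2 - alpha).

Definition right_deriv {R : realType} (alpha b0 : R) (g : R -> R) (x : R)
    : R[i] :=
  expi (- (pi * alpha)) / (Gamma alpha)%:C *
  (g x / (b0 - x) `^ (1 - alpha) +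
   (1 - alpha) *
   \int[@lebesgue_measure R]_(u in `[x, b0]) right_kernel alpha g x u)%:C.

(* g_{b0-} *)
Definition shift_end {R : realType} (g : R -> R) (b0 x : R) : R := g x - g b0.

(* D^alpha_{a0+} f exists a.e. and is in L_1[a0, b0] *)
Definition left_deriv_L1 {R : realType} (alpha a0 b0 : R) (f : R -> R) : Prop :=
  {ae @lebesgue_measure R, forall x, x \in `]a0, b0[ ->
     (@lebesgue_measure R).-integrable `[a0, x]
       (EFin \o left_kernel alpha f x)} /\
  (@lebesgue_measure R).-integrable `[a0, b0]
    (EFin \o left_deriv alpha a0 f).

(* D^{1-alpha}_{b0-} g exists a.e. and is in L_infty[a0, b0] *)
Definition right_deriv_Linfty {R : realType} (alpha a0 b0 : R) (g : R -> R)
    : Prop :=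
  [/\ {ae @lebesgue_measure R, forall x, x \in `]a0, b0[ ->
        (@lebesgue_measure R).-integrable `[x, b0]
          (EFin \o right_kernel alpha g x)},
      measurable_fun `[a0, b0] (fun x => complex.Re (right_deriv alpha b0 g x)),
      measurable_fun `[a0, b0] (fun x => complex.Im (right_deriv alpha b0 g x))
    & exists C : R, {ae @lebesgue_measure R, forall x, x \in `[a0, b0] ->
        ComplexField.Normc.normc (right_deriv alpha b0 g x) <= C}].

Definition gls_integrable {R : realType} (alpha a0 b0 : R) (f g : R -> R)
    : Prop :=
  left_deriv_L1 alpha a0 b0 f /\
  right_deriv_Linfty alpha a0 b0 (shift_end g b0).

(* Generalized Lebesgue-Stieltjes integral of f with respect to g.  As the phases
   expi (pi * alpha) and expi (- (pi * alpha)) cancel, this normalization gives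
   g a0 - g b0 for f = 1, the opposite of the Riemann-Stieltjes sign.  For
   [sde_solution] this amounts to exchanging b with - b, under which
   [coefficients] is invariant. *)
Definition gls_integral {R : realType} (alpha a0 b0 : R) (f g : R -> R)
    : R[i] :=
  expi (pi * alpha) *
  Cintegral `[a0, b0] (fun x =>
    (left_deriv alpha a0 f x)%:C * right_deriv alpha b0 (shift_end g b0) x).

Definition Zfun {R : realType} (alpha : R) (g : R -> R) (u v : R) : R[i] :=
  right_deriv alpha v (shift_end g v) u.

(* extended-real valued, as the supremum may be infinite on a null set of
   paths *)
Definition Lambda {R : realType} (alpha beta : R) (g : R -> R) (t1 t2 : R)
    : \bar R :=
  maxe 1%E (ereal_sup [set z | exists u v : R, [/\ t1 <= u, u < v, v <= t2 &
    z = (ComplexField.Normc.normc (Zfun alpha g u v) /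
         (v - u) `^ (beta + alpha - 1))%:E]]).

Definition locally_holder {R : realType} (gamma : R) (f : R -> R) : Prop :=
  forall S : R, 0 < S -> exists C : R, forall s t : R,
    0 <= s <= S -> 0 <= t <= S -> `|f s - f t| <= C * `|s - t| `^ gamma.

Definition holder_below {R : realType} (H : R) (f : R -> R) : Prop :=
  forall gamma : R, 0 < gamma < H -> locally_holder gamma f.

(* [normal_prob m 0] is not the degenerate law, hence the case distinction *)
Definition gaussian_law {R : realType} (m s : R) (A : set R) : \bar R :=
  if s == 0 then \d_m A else normal_prob m s A.

(* Processes are indexed by all of R so that they are plain families of random
   variables; only the times t >= 0 matter. *)
Definition gaussian_process {R : realType} (d : measure_display)
    (T : measurableType d) (P : probability T R) (B : R -> {RV P >-> R})
    : Prop :=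
  forall (n : nat) (t c : 'I_n -> R), (forall i, 0 <= t i) ->
    exists m s : R, forall A : set R, measurable A ->
      P ((fun w => \sum_(i < n) c i * B (t i) w) @^-1` A) = gaussian_law m s A.

Record fractional_brownian_motion {R : realType} (d : measure_display)
    (T : measurableType d) (P : probability T R) (H : R)
    (B : R -> {RV P >-> R}) : Prop := {
  fbm_gaussian : gaussian_process B;
  fbm_centered : forall t : R, 0 <= t -> ('E_P[B t] = 0)%E;
  fbm_covariance : forall s t : R, 0 <= s -> 0 <= t ->
    ('E_P[fun w => (B t w * B s w)%R] =
     (2^-1 * (s `^ (2 * H) + t `^ (2 * H) - `|t - s| `^ (2 * H)))%:E)%E;
  fbm_paths : {ae P, forall w, holder_below H (fun t => B t w)}
}.

Record coefficients {R : realType} (delta K L : R) (RN : nat -> R)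
    (a b : R -> R) : Prop := {
  coef_bounded : forall x : R, `|a x| + `|b x| <= K;
  coef_lipschitz : forall x y : R, `|a x - a y| + `|b x - b y| <= L * `|x - y|;
  coef_derivable : forall x : R, derivable b x 1;
  coef_deriv_holder : forall N : nat, (1 <= N)%N -> forall x y : R,
    - N%:R <= x <= N%:R -> - N%:R <= y <= N%:R ->
    `|derive1 b x - derive1 b y| <= RN N * `|x - y| `^ delta
}.

(* X solves X_t = x0 + int_0^t a(X_s) ds + int_0^t b(X_s) dB_s in the class of
   processes whose paths are locally Hoelder of every order less than H, where
   existence and uniqueness hold.  For t = 0 all integrals are over a null set
   and the equation reads X_0 = x0. *)
Definition sde_solution {R : realType} (d : measure_display)
    (T : measurableType d) (P : probability T R) (H alpha : R) (a b : R -> R)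
    (x0 : R) (B X : R -> {RV P >-> R}) : Prop :=
  {ae P, forall w,
    holder_below H (fun t => X t w) /\
    forall t : R, 0 <= t ->
      gls_integrable alpha 0 t (fun s => b (X s w)) (fun s => B s w) /\
      (X t w)%:C =
        (x0 + \int[@lebesgue_measure R]_(s in `[0, t]) a (X s w))%:C +
        gls_integral alpha 0 t (fun s => b (X s w)) (fun s => B s w)}.

(* Main.v *)
Require Import Defs.
From HB Require Import structures.
From mathcomp Require Import all_boot all_order all_algebra.
From mathcomp Require Import all_classical all_reals all_analysis.
From mathcomp Require Import measurable_realfun.
From mathcomp.real_closed Require Import complex.
From mathcomp Require Import ring lra.

Set Implicit Arguments.
Unset Strict Implicit.
Unset Printing Implicit Defensive.

Import Order.TTheory GRing.Theory Num.Theory.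
Import numFieldNormedType.Exports.

Local Open Scope classical_set_scope.
Local Open Scope ring_scope.

(** The bound is pathwise and deterministic.  Write W_s f for the left fractional
    derivative of order alpha started at s, up to its Gamma factor, and suppose
    that for every s < t
<<
      X_t - X_s = int_s^t a(X) + const * int_s^t W_s(b o X)(u) Z(u, t) du.
>>
    By the definition of Lambda, Z(u, t) is at most Lambda (t - u)^(beta+alpha-1)
    in absolute value.  If A is a beta-Hoelder constant of X on [s, t], then
    W_s(b o X)(u) is at most K (u - s)^(-alpha) + C L A (u - s)^(beta-alpha), so two
    beta integrals give ([frac_integral_local_le], [increment_local])
<<
      |X_t - X_s| <= Lambda (c1 (t - s)^beta + c2 A (t - s)^(2 beta)).
>>
    On intervals so short that c2 Lambda (t - s)^beta <= 1/2 this turns the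
    constant A into the constant c1 Lambda + A/2; iterating, 2 c1 Lambda is a
    Hoelder constant there ([holder_short]).  The admissible length is of order
    Lambda^(-1/beta), so that [t1, t2] splits into at most
    1 + C Lambda^(1/beta) (t2 - t1) such intervals, on each of which X moves by at
    most a constant; adding up gives both terms of the bound ([increment_le]).

    The formula for X_t - X_s is the delicate point.  The equation is only given on
    intervals [0, t], and the fractional derivative depends on its starting point,
    so one has to know that the generalized Stieltjes integral is additive
    ([frac_integral_cat]).  For absolutely continuous f and g this is elementary:
    the hypersingular kernels integrate out ([frac_deriv_ac]), Dirichlet's formula
    and Abel inversion ([frac_deriv_abel]) reduce the integral to a constant times
    int f g', and the constant does not depend on the interval.  Hoelder functions
    are approximated by their averages over [x, x + h]: these are absolutely
    continuous and have the same Hoelder exponents and constants, so the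
    fractional derivatives converge pointwise with a common integrable bound
    ([cvg_frac_integral]). *)

(** * Affine changes of variables *)

Section change_of_variables.
Context {R : realType}.
Local Notation mu := (@lebesgue_measure R).
Implicit Types (c r s t : R) (f : R -> R).

Lemma measurable_affine c r : measurable_fun [set: R] (fun y : R => c + r * y).
Proof. by apply: measurable_funD => //; exact: measurable_funM. Qed.

Lemma lebesgue_measure_affine c r (r0 : 0 < r) (A : set R) : measurable A ->
  mu A = (r%:E * mu ((fun y => c + r * y)%R @^-1` A))%E.
Proof.
move=> mA.
pose phi := (fun y : measurableTypeR R => c + r * y : measurableTypeR R).
have mphi : measurable_fun setT phi by exact: measurable_affine.
pose k : {nonneg R} := NngNum (ltW r0).
rewrite (@lebesgue_measure_unique R (mscale k (pushforward mu phi)))//.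
move=> _ [[a b] _ <-].
change (mu `]a, b]%classic = (r%:E * mu (phi @^-1` `]a, b]%classic))%E).
have -> : (phi @^-1` `]a, b]%classic) = `](a - c) / r, (b - c) / r]%classic.
  apply/seteqP; split => x /=; rewrite !in_itv/= /phi.
    by rewrite ltr_pdivrMr// ler_pdivlMr// => /andP[? ?]; apply/andP; split; lra.
  by rewrite ltr_pdivrMr// ler_pdivlMr// => /andP[? ?]; apply/andP; split; lra.
rewrite !lebesgue_measure_itv/= !lte_fin.
rewrite ltr_pM2r ?invr_gt0// ltrD2r; case: ifPn => _; last by rewrite mule0.
by rewrite -!EFinD -EFinM; congr EFin; field; rewrite gt_eqF.
Qed.

Lemma ge0_integral_affine c r s t (f : R -> \bar R) : 0 < r ->
  measurable_fun setT f -> (forall x, 0 <= f x)%E ->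
  (\int[mu]_(x in `[(c + r * s)%R, (c + r * t)%R]) f x =
   r%:E * \int[mu]_(y in `[s, t]) f (c + r * y)%R)%E.
Proof.
move=> r0 mf f0.
pose phi := (fun y : measurableTypeR R => c + r * y : measurableTypeR R).
have mphi : measurable_fun setT phi by exact: measurable_affine.
pose k : {nonneg R} := NngNum (ltW r0).
have -> : `[s, t]%classic = phi @^-1` `[c + r * s, c + r * t]%classic.
  by apply/seteqP; split => x /=; rewrite !in_itv/= /phi !lerD2l !ler_pM2l.
rewrite -(ge0_integral_pushforward mphi)//; last exact: measurable_funS mf.
rewrite -[r]/(k%:num) -ge0_integral_mscale//; last exact: measurable_funS mf.
by apply: eq_measure_integral => A mA _; exact: lebesgue_measure_affine.
Qed.

Lemma ge0_integral_reflect s t (f : R -> \bar R) :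
  measurable_fun setT f -> (forall x, 0 <= f x)%E ->
  (\int[mu]_(x in `[s, t]) f x = \int[mu]_(y in `[(- t)%R, (- s)%R]) f (- y)%R)%E.
Proof.
move=> mf f0.
have -> : `[- t, - s]%classic = (-%R : _ -> measurableTypeR R) @^-1` `[s, t].
  by apply/seteqP; split => x /=; rewrite !in_itv/= => /andP[? ?]; apply/andP; split; lra.
rewrite -ge0_integral_pushforward//=; last exact: measurable_funS mf.
by apply: eq_measure_integral => //= A mA AS; exact/esym/lebesgue_measureN.
Qed.

Lemma Rintegral_affine c r s t f : 0 < r -> measurable_fun setT f ->
  \int[mu]_(x in `[c + r * s, c + r * t]) f x =
  r * \int[mu]_(y in `[s, t]) f (c + r * y).
Proof.
move=> r0 mf; rewrite /Rintegral.
have mF : measurable_fun setT (EFin \o f) by exact/measurable_EFinP.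
rewrite integralE [in RHS]integralE.
rewrite !ge0_integral_affine//; try exact: measurable_funepos; try exact: measurable_funeneg.
have <- : forall x : \bar R, fine (r%:E * x)%E = r * fine x.
  by case=> //=; rewrite /mule/= ?gt_eqF//= ?lte_fin ?r0 //= mulr0.
congr fine.
have -> : (\int[mu]_(y in `[s, t]) (EFin \o f)^\+ (c + r * y)%R =
  \int[mu]_(y in `[s, t]) (fun y => (f (c + r * y))%:E)^\+ y)%E.
  by apply: eq_integral => y _; rewrite (funepos_comp (EFin \o f) (fun y => c + r * y)).
have -> : (\int[mu]_(y in `[s, t]) (EFin \o f)^\- (c + r * y)%R =
  \int[mu]_(y in `[s, t]) (fun y => (f (c + r * y))%:E)^\- y)%E.
  by apply: eq_integral => y _; rewrite (funeneg_comp (EFin \o f) (fun y => c + r * y)).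
set A := (\int[_]_(_ in _) _)%E; set B := (\int[_]_(_ in _) _)%E.
have : (0 <= A)%E by exact: integral_ge0.
have : (0 <= B)%E by exact: integral_ge0.
case: A => [a| |]; case: B => [b| |] //= _ _.
- by rewrite -(EFinD a) -!(EFinM r) -(EFinD (r * a)) mulrDr mulrN.
- by rewrite gt0_muley ?lte_fin//= gt0_muleNy ?lte_fin.
- by rewrite !gt0_muley ?lte_fin.
- by rewrite !gt0_muley ?lte_fin//= gt0_muleNy ?lte_fin.
Qed.

Lemma Rintegral_reflect s t f : measurable_fun setT f ->
  \int[mu]_(x in `[s, t]) f x = \int[mu]_(y in `[- t, - s]) f (- y).
Proof.
move=> mf; rewrite /Rintegral.
have mF : measurable_fun setT (EFin \o f) by exact/measurable_EFinP.
rewrite integralE [in RHS]integralE.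
congr (fine (_ - _))%E; rewrite ge0_integral_reflect//.
- by apply: eq_integral => y _; rewrite (funepos_comp (EFin \o f) -%R).
- exact: measurable_funepos.
- by apply: eq_integral => y _; rewrite (funeneg_comp (EFin \o f) -%R).
- exact: measurable_funeneg.
Qed.

Lemma integrable_affine c r s t f : 0 < r -> measurable_fun setT f ->
  mu.-integrable `[s, t] (EFin \o (fun y => f (c + r * y))) ->
  mu.-integrable `[c + r * s, c + r * t] (EFin \o f).
Proof.
move=> r0 mf /integrableP[_ fi]; apply/integrableP; split.
  by apply: measurable_funTS; exact/measurable_EFinP.
rewrite (@ge0_integral_affine _ _ _ _ (fun x => `|(EFin \o f) x|%E))//.
  by rewrite lte_mul_pinfty// lee_fin ltW.
by apply: measurableT_comp => //; exact/measurable_EFinP.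
Qed.

Lemma integrable_reflect s t f : measurable_fun setT f ->
  mu.-integrable `[- t, - s] (EFin \o (fun y => f (- y))) ->
  mu.-integrable `[s, t] (EFin \o f).
Proof.
move=> mf /integrableP[_ fi]; apply/integrableP; split.
  by apply: measurable_funTS; exact/measurable_EFinP.
rewrite (@ge0_integral_reflect _ _ (fun x => `|(EFin \o f) x|%E))//.
by apply: measurableT_comp => //; exact/measurable_EFinP.
Qed.

End change_of_variables.

(** * Integrals over compact intervals *)

Section integrable_itv.
Context {R : realType}.
Local Notation mu := (@lebesgue_measure R).
Implicit Types (s t x : R) (f g : R -> R).

Lemma eq_integrable_itv s t f g : (forall x, s <= x <= t -> f x = g x) ->
  mu.-integrable `[s, t] (EFin \o f) -> mu.-integrable `[s, t] (EFin \o g).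
Proof.
move=> fg; apply: eq_integrable => // x; rewrite inE/= in_itv/= => xst.
by rewrite fg.
Qed.

Lemma integrable_itvZl s t k f : mu.-integrable `[s, t] (EFin \o f) ->
  mu.-integrable `[s, t] (EFin \o (fun x => k * f x)).
Proof.
move=> fi; rewrite (_ : _ \o _ = (fun x => k%:E * (EFin \o f) x)%E)//.
exact: integrableZl.
Qed.

Lemma integrable_itvD s t f g : mu.-integrable `[s, t] (EFin \o f) ->
  mu.-integrable `[s, t] (EFin \o g) ->
  mu.-integrable `[s, t] (EFin \o (fun x => f x + g x)).
Proof.
move=> fi gi; rewrite (_ : _ \o _ = ((EFin \o f) \+ (EFin \o g))%E)//.
exact: integrableD.
Qed.

Lemma integrable_itv_le s t f g : measurable_fun `[s, t] f ->
  (forall x, s <= x <= t -> `|f x| <= g x) ->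
  mu.-integrable `[s, t] (EFin \o g) -> mu.-integrable `[s, t] (EFin \o f).
Proof.
move=> mf fg; apply: le_integrable => //; first exact/measurable_EFinP.
move=> x /=; rewrite in_itv/= => xst; rewrite lee_fin.
by rewrite (le_trans (fg x xst))// ler_norm.
Qed.

Lemma integrable_itv_cst s t (k : R) : mu.-integrable `[s, t] (EFin \o cst k).
Proof.
apply: measurable_bounded_integrable => //.
- change (mu `[s, t]%classic < +oo)%E.
  by rewrite lebesgue_measure_itv; case: ifP; rewrite ?ltry// -EFinB ltry.
- by exists `|k|; split => // y ky x _ /=; exact: ltW.
Qed.

Lemma integrable_itv_bounded s t f (C : R) : measurable_fun `[s, t] f ->
  (forall x, s <= x <= t -> `|f x| <= C) -> mu.-integrable `[s, t] (EFin \o f).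
Proof. by move=> mf fC; apply: integrable_itv_le (integrable_itv_cst s t C). Qed.

Lemma eq_Rintegral_itv s t f g : (forall x, s <= x <= t -> f x = g x) ->
  \int[mu]_(x in `[s, t]) f x = \int[mu]_(x in `[s, t]) g x.
Proof. by move=> fg; apply: eq_Rintegral => x; rewrite inE/= in_itv/= => /fg. Qed.

Lemma eq_Rintegral_oo s t f g : measurable_fun `[s, t] f -> measurable_fun `[s, t] g ->
  (forall x, s < x < t -> f x = g x) ->
  \int[mu]_(x in `[s, t]) f x = \int[mu]_(x in `[s, t]) g x.
Proof.
move=> mf mg fg; rewrite /Rintegral.
have sub : `]s, t[ `<=` `[s, t]%classic by exact: subset_itv_oo_cc.
have mE h : measurable_fun `[s, t] h -> measurable_fun `]s, t[ (EFin \o h).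
  by move=> mh; apply/measurable_EFinP; apply: measurable_funS mh.
rewrite !(@integral_itv_bndoo _ _ _ _ true false); [|exact: mE..].
congr fine; apply: eq_integral => x; rewrite inE/= in_itv/= => /fg.
by move=> ->.
Qed.

Lemma Rintegral_itv_cst s t (k : R) : s <= t -> \int[mu]_(x in `[s, t]) k = k * (t - s).
Proof.
move=> st; rewrite Rintegral_cst//; change (k * fine (mu `[s, t]%classic) = k * (t - s)).
rewrite lebesgue_measure_itv/= lte_fin.
case: ifP => // /negbT; rewrite -leNgt => ts.
by rewrite /= (_ : t = s) ?subrr//; apply/le_anti; rewrite st ts.
Qed.

Lemma Rintegral_itv_cat s t m f : s <= m <= t -> mu.-integrable `[s, t] (EFin \o f) ->
  \int[mu]_(x in `[s, t]) f x =
  \int[mu]_(x in `[s, m]) f x + \int[mu]_(x in `[m, t]) f x.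
Proof.
move=> /andP[sm mt] fi.
have := @Rintegral_itvB _ f (BLeft s) (BRight t) m fi.
rewrite !bnd_simp => /(_ sm mt) E.
rewrite -(@Rintegral_itv_obnd_cbnd _ m (BRight t)); last first.
  by apply: integrableS fi => //; apply: subset_itv; rewrite bnd_simp.
by rewrite -E addrC subrK.
Qed.

Lemma le_Rintegral_itv s t f g : mu.-integrable `[s, t] (EFin \o f) ->
  mu.-integrable `[s, t] (EFin \o g) -> (forall x, s <= x <= t -> f x <= g x) ->
  \int[mu]_(x in `[s, t]) f x <= \int[mu]_(x in `[s, t]) g x.
Proof.
move=> fi gi fg; apply: le_Rintegral => // x; rewrite /= in_itv/=; exact: fg.
Qed.

Lemma ler_norm_Rintegral_itv s t f g : measurable_fun `[s, t] f ->
  (forall x, s <= x <= t -> `|f x| <= g x) ->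
  mu.-integrable `[s, t] (EFin \o g) ->
  `|\int[mu]_(x in `[s, t]) f x| <= \int[mu]_(x in `[s, t]) g x.
Proof.
move=> mf fg gi; have fi := integrable_itv_le mf fg gi.
apply: le_trans (le_normr_Rintegral _ fi) _ => //.
apply: le_Rintegral_itv => //; exact: (integrable_norm fi).
Qed.

End integrable_itv.

(** * Power singularities and beta integrals *)

Section beta_integrals.
Context {R : realType}.
Local Notation mu := (@lebesgue_measure R).
Implicit Types (a b p q r s t x y : R).

Lemma integral_powR a b p : 0 < a -> a <= b -> p + 1 != 0 ->
  (\int[mu]_(x in `[a, b]) (x `^ p)%:E =
   ((b `^ (p + 1) - a `^ (p + 1)) / (p + 1))%:E)%E.
Proof.
move=> a0; rewrite le_eqVlt => /predU1P[<- _|ab p1].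
  by rewrite set_itv1 integral_set1 subrr mul0r.
have pos x : a <= x -> 0 < x by exact: lt_le_trans.
have dp q x : a <= x -> derivable (fun y : R => y `^ q) x 1.
  by move=> ax; apply: derivable_powR; rewrite in_itv/= andbT pos.
have cp q x : a <= x -> {for x, continuous (fun y : R => y `^ q)}.
  by move=> ax; apply: differentiable_continuous; apply/derivable1_diffP; exact: dp.
rewrite (@continuous_FTC2 _ _ (fun x => (p + 1)^-1 * x `^ (p + 1)))//.
- by rewrite -EFinB mulrBl ![_ * (p + 1)^-1]mulrC.
- apply: derivable_within_continuous => x; rewrite in_itv/= => /andP[ax _]; exact: dp.
- split.
  + move=> x; rewrite in_itv/= => /andP[ax _].
    by apply: derivableM => //; apply: dp; exact: ltW.
  + by apply: cvg_at_right_filter; apply: cvgM; [exact: cvg_cst|exact: cp].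
  + by apply: cvg_at_left_filter; apply: cvgM; [exact: cvg_cst|exact/cp/ltW].
- move=> x; rewrite in_itv/= => /andP[ax _].
  have x0 : 0 < x by apply: pos; exact: ltW.
  rewrite derive1E deriveM//; last by apply: dp; exact: ltW.
  rewrite derive_cst scaler0 addr0.
  have [_ ->] := is_derive1_powR (p + 1) x0.
  by rewrite /GRing.scale/= mulrA mulVf// mul1r addrK.
Qed.

Lemma integrable_powR01 p : -1 < p ->
  mu.-integrable `[0, 1] (EFin \o (fun x : R => x `^ p)).
Proof.
move=> p1; have p10 : 0 < p + 1 by lra.
have mp : measurable_fun setT (EFin \o (@powR R ^~ p)).
  by apply/measurable_EFinP; exact: measurable_powR.
apply/integrableP; split; first exact: measurable_funTS.
rewrite -integral_itv_obnd_cbnd; last first.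
  by apply: measurableT_comp => //; exact: measurable_funTS.
pose F n := `[(n.+1%:R)^-1, 1 : R]%classic.
have -> : `]0, 1 : R]%classic = \bigcup_n F n.
  apply/seteqP; split => x /=.
    rewrite in_itv/= => /andP[x0 x1].
    exists (Num.trunc x^-1) => //; rewrite /F/= in_itv/= x1 andbT.
    rewrite invf_ple ?posrE//; exact/ltW/truncnS_gt.
  move=> [n _]; rewrite /F/= !in_itv/= => /andP[nx ->]; rewrite andbT.
  by apply: lt_le_trans nx; rewrite invr_gt0.
have ndF : {homo F : n m / (n <= m)%N >-> (n <= m)%O}.
  move=> n m nm; apply/subsetPset => x; rewrite /F/= !in_itv/= => /andP[nx ->].
  rewrite andbT; apply: le_trans nx; rewrite lef_pV2 ?posrE// ler_nat//.
have cF : (\int[mu]_(x in F n) `|(x `^ p)%:E| @[n --> \oo] -->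
    \int[mu]_(x in \bigcup_n F n) `|(x `^ p)%:E|)%E.
  apply: ge0_nondecreasing_set_cvg_integral => //.
  - by move=> n; exact: measurable_itv.
  - by move=> i; apply: measurableT_comp => //; exact: measurable_funTS.
rewrite -(cvg_lim _ cF)//; apply: (@le_lt_trans _ _ ((p + 1)^-1)%:E); last exact: ltry.
apply: lime_le; first by apply/cvg_ex; eexists; exact: cF.
apply: nearW => n; rewrite /F.
under eq_integral do rewrite /= ger0_norm ?powR_ge0//.
rewrite integral_powR ?invr_gt0//; last 2 first.
- by rewrite invf_le1// ler1n.
- by rewrite gt_eqF.
by rewrite lee_fin powR1 ler_pdivrMr// mulVf ?gt_eqF// gerBl powR_ge0.
Qed.

Lemma measurable_beta p q s t :
  measurable_fun setT (fun x => (x - s) `^ p * (t - x) `^ q).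
Proof.
apply: measurable_funM; apply: (measurableT_comp (measurable_powR _)) => //;
  exact: measurable_funB.
Qed.

(** On either half of [0, 1] one of the two factors is bounded. *)
Lemma beta_le p q y : 0 <= y <= 1 ->
  y `^ p * (1 - y) `^ q <=
  (1 + 2^-1 `^ q) * y `^ p + (1 + 2^-1 `^ p) * (1 - y) `^ q.
Proof.
have half r z : 2^-1 <= z <= 1 -> z `^ r <= 1 + 2^-1 `^ r.
  move=> /andP[z2 z1]; have z0 : 0 < z by apply: lt_le_trans z2; rewrite invr_gt0.
  have [r0|r0] := leP 0 r.
    apply: (@le_trans _ _ (1 `^ r)); first by rewrite ge0_ler_powR// nnegrE// ltW.
    by rewrite powR1 lerDl powR_ge0.
  apply: (@le_trans _ _ (2^-1 `^ r)); last by rewrite lerDr.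
  rewrite -[r]opprK powRN [leRHS]powRN lef_pV2 ?posrE ?powR_gt0 ?invr_gt0//.
  by rewrite ge0_ler_powR// ?nnegrE ?oppr_ge0 ?invr_ge0// ltW.
move=> /andP[y0 y1]; have [y2|y2] := leP y 2^-1.
  rewrite -[leLHS]addr0 lerD//; last by rewrite mulr_ge0 ?addr_ge0 ?powR_ge0.
  by rewrite mulrC ler_wpM2r ?powR_ge0// half//; apply/andP; split; lra.
rewrite -[leLHS]add0r lerD//; first by rewrite mulr_ge0 ?addr_ge0 ?powR_ge0.
by rewrite ler_wpM2r ?powR_ge0// half//; apply/andP; split; lra.
Qed.

Lemma integrable_beta01 p q : -1 < p -> -1 < q ->
  mu.-integrable `[0, 1] (EFin \o (fun y : R => (y - 0) `^ p * (1 - y) `^ q)).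
Proof.
move=> p1 q1.
have iq : mu.-integrable `[0, 1] (EFin \o (fun y : R => (1 - y) `^ q)).
  have mq (b : R) : measurable_fun setT (fun y : R => (b - y) `^ q).
    by apply: (measurableT_comp (measurable_powR _)) => //; exact: measurable_funB.
  apply: integrable_reflect; first exact: mq.
  have -> : `[- 1, - 0]%classic = `[- 1 + 1 * 0, - 1 + 1 * 1 : R]%classic.
    by rewrite mulr0 mulr1 addr0 addNr oppr0.
  apply: integrable_affine => //.
    by apply: (measurableT_comp (mq 1)).
  apply: eq_integrable_itv (integrable_powR01 q1) => x _.
  by congr (_ `^ _); ring.
have ipq : mu.-integrable `[0, 1] (EFin \o (fun y : R =>
   (1 + 2^-1 `^ q) * y `^ p + (1 + 2^-1 `^ p) * (1 - y) `^ q)).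
  by apply: integrable_itvD; apply: integrable_itvZl => //; exact: integrable_powR01.
apply: le_integrable ipq => //.
  by apply: measurable_funTS; apply/measurable_EFinP; exact: measurable_beta.
move=> y /=; rewrite in_itv/= => y01; rewrite lee_fin subr0.
rewrite ger0_norm ?mulr_ge0 ?powR_ge0// (le_trans (beta_le p q y01))//.
exact: ler_norm.
Qed.

(** Euler's B(p + 1, q + 1), indexed by the exponents of the integrand. *)
Definition beta_int p q : R := \int[mu]_(y in `[0, 1]) ((y - 0) `^ p * (1 - y) `^ q).

Let beta_scaled p q s t y : s < t -> 0 <= y <= 1 ->
  (s + (t - s) * y - s) `^ p * (t - (s + (t - s) * y)) `^ q =
  (t - s) `^ (p + q) * ((y - 0) `^ p * (1 - y) `^ q).
Proof.
move=> st /andP[y0 y1].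
have ts0 : 0 < t - s by lra.
rewrite (_ : s + (t - s) * y - s = (t - s) * (y - 0)); last by ring.
rewrite (_ : t - (s + (t - s) * y) = (t - s) * (1 - y)); last by ring.
rewrite !powRM//; try lra.
rewrite powRD; last by rewrite (gt_eqF ts0) implybT.
by rewrite mulrACA.
Qed.

Lemma integrable_beta p q s t : -1 < p -> -1 < q -> s <= t ->
  mu.-integrable `[s, t] (EFin \o (fun x => (x - s) `^ p * (t - x) `^ q)).
Proof.
move=> p1 q1; rewrite le_eqVlt => /predU1P[<-|st].
  rewrite set_itv1; apply: null_set_integrable => //; last exact: lebesgue_measure_set1.
  by apply: measurable_funTS; apply/measurable_EFinP; exact: measurable_beta.
have ts0 : 0 < t - s by lra.
have -> : `[s, t]%classic = `[s + (t - s) * 0, s + (t - s) * 1]%classic.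
  by rewrite mulr0 mulr1 addr0 addrC subrK.
apply: integrable_affine => //; first exact: measurable_beta.
apply: eq_integrable_itv (integrable_itvZl ((t - s) `^ (p + q)) (integrable_beta01 p1 q1)) => y y01.
by rewrite beta_scaled.
Qed.

Lemma Rintegral_beta p q s t : -1 < p -> -1 < q -> s < t ->
  \int[mu]_(x in `[s, t]) ((x - s) `^ p * (t - x) `^ q) =
  beta_int p q * (t - s) `^ (p + q + 1).
Proof.
move=> p1 q1 st; have ts0 : 0 < t - s by lra.
have -> : `[s, t]%classic = `[s + (t - s) * 0, s + (t - s) * 1]%classic.
  by rewrite mulr0 mulr1 addr0 addrC subrK.
rewrite Rintegral_affine//; last exact: measurable_beta.
rewrite (@eq_Rintegral_itv _ _ _ _ (fun y => (t - s) `^ (p + q) * ((y - 0) `^ p * (1 - y) `^ q))).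
  rewrite RintegralZl//; last exact: integrable_beta01.
  rewrite (@powRD _ _ (p + q) 1); last by rewrite (gt_eqF ts0) implybT.
  rewrite powRr1 ?ltW// -/(beta_int p q); ring.
by move=> y y01; exact: beta_scaled.
Qed.

(** For conjugate exponents the length of the interval drops out: this scale
    invariance is what makes Abel inversion work. *)
Lemma Rintegral_beta_conj a s t : 0 < a < 1 -> s < t ->
  \int[mu]_(x in `[s, t]) ((x - s) `^ (- a) * (t - x) `^ (- (1 - a))) =
  beta_int (- a) (- (1 - a)).
Proof.
move=> /andP[a0 a1] st; rewrite Rintegral_beta//; [|lra|lra].
by rewrite (_ : - a + - (1 - a) + 1 = 0) ?powRr0 ?mulr1//; ring.
Qed.

Lemma beta_int_ge0 p q : 0 <= beta_int p q.
Proof. by apply: Rintegral_ge0 => y _; rewrite mulr_ge0// powR_ge0. Qed.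

Lemma integrable_powR_left p s t : -1 < p -> s <= t ->
  mu.-integrable `[s, t] (EFin \o (fun x => (x - s) `^ p)).
Proof.
move=> p1 st; have := @integrable_beta p 0 s t p1 (@ltrN10 _) st.
by apply: eq_integrable_itv => y _; rewrite powRr0 mulr1.
Qed.

Lemma integrable_powR_right q s t : -1 < q -> s <= t ->
  mu.-integrable `[s, t] (EFin \o (fun x => (t - x) `^ q)).
Proof.
move=> q1 st; have := @integrable_beta 0 q s t (@ltrN10 _) q1 st.
by apply: eq_integrable_itv => y _; rewrite powRr0 mul1r.
Qed.

Lemma Rintegral_powR_right q s t : -1 < q -> s < t ->
  \int[mu]_(x in `[s, t]) (t - x) `^ q = beta_int 0 q * (t - s) `^ (q + 1).
Proof.
move=> q1 st; have := @Rintegral_beta 0 q s t (@ltrN10 _) q1 st.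
by rewrite add0r => <-; apply: eq_Rintegral => y _; rewrite powRr0 mul1r.
Qed.

End beta_integrals.

(** * Integrals depending on a parameter *)

Section parameter_integrals.
Context {R : realType}.
Local Notation mu := (@lebesgue_measure R).
Implicit Types (s t x u : R) (K : R * R -> R).

(* K cut off to the open triangle s <= u < x < t, so that Fubini applies on
   the whole plane *)
Let below s t K (z : R * R) : R :=
  if [&& s <= z.2, z.2 < z.1 & z.1 < t] then K z else 0.

Let measurable_below s t K : measurable_fun setT K ->
  measurable_fun setT (below s t K).
Proof.
move=> mK; apply: measurable_fun_if => //.
  apply: measurable_and; first exact: measurable_fun_ler.
  apply: measurable_and; first exact: measurable_fun_ltr.
  exact: measurable_fun_ltr.
exact: measurable_funS mK.
Qed.

Let integral_below1 s t x K : measurable_fun setT K -> s < x < t ->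
  (\int[mu]_u (below s t K (x, u))%:E = \int[mu]_(u in `[s, x]) (K (x, u))%:E)%E.
Proof.
move=> mK /andP[sx xt].
rewrite -integral_itv_bndo_bndc; last first.
  apply/measurable_EFinP; apply: measurable_funTS.
  by apply: (measurableT_comp mK); exact: measurable_pair1.
rewrite [RHS]integral_mkcond; apply: eq_integral => u _.
rewrite /below/= xt andbT patchE/=.
by rewrite mem_setE in_itv/=; case: ifP.
Qed.

Let integral_below1_out s t x K : ~~ (s < x < t) ->
  (\int[mu]_u (below s t K (x, u))%:E = 0)%E.
Proof.
move=> sxt; rewrite integral0_eq// => u _; rewrite /below/=.
case: ifP => // /and3P[su ux xt].
by rewrite xt (le_lt_trans su ux) in sxt.
Qed.

Let integral_below2 s t u K : measurable_fun setT K -> s <= u ->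
  (\int[mu]_x (below s t K (x, u))%:E = \int[mu]_(x in `[u, t]) (K (x, u))%:E)%E.
Proof.
move=> mK su.
rewrite (@integral_itv_bndoo _ _ _ _ true false); last first.
  apply/measurable_EFinP; apply: measurable_funTS.
  by apply: (measurableT_comp mK); exact: measurable_pair2.
rewrite [RHS]integral_mkcond; apply: eq_integral => x _.
rewrite /below/= su/= patchE/=.
by rewrite mem_setE in_itv/=; case: ifP.
Qed.

Let integral_below2_out s t u K : u < s ->
  (\int[mu]_x (below s t K (x, u))%:E = 0)%E.
Proof.
move=> us; rewrite integral0_eq// => x _; rewrite /below/=.
by rewrite leNgt us.
Qed.

(** No integrability is needed: the positive and negative parts depend
    measurably on x by Tonelli, and taking [fine] of their difference keeps this
    even where it is infinite. *)
Lemma measurable_Rintegral_param s K : measurable_fun setT K ->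
  measurable_fun setT (fun x => \int[mu]_(u in `[s, x]) K (x, u)).
Proof.
move=> mK.
pose K' (z : R * R) := if (s <= z.2) && (z.2 <= z.1) then K z else 0.
have mK' : measurable_fun setT (EFin \o K').
  apply/measurable_EFinP; apply: measurable_fun_if => //.
    by apply: measurable_and; exact: measurable_fun_ler.
  exact: measurable_funS mK.
have -> : (fun x => \int[mu]_(u in `[s, x]) K (x, u)) =
  fine \o (fun x => \int[mu]_u (EFin \o K')^\+ (x, u) - \int[mu]_u (EFin \o K')^\- (x, u))%E.
  apply/funext => x /=; rewrite Rintegral_mkcond /Rintegral integralE.
  congr (fine (_ - _))%E; apply: eq_integral => u _.
    rewrite !unlock /K' patchE mem_setE in_itv/=; by case: ifP.
  rewrite !unlock /K' patchE mem_setE in_itv/=; by case: ifP.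
apply: measurableT_comp; first exact: fine_measurable.
apply: emeasurable_funB.
  apply: measurable_fun_fubini_tonelli_F => //; exact: measurable_funepos.
apply: measurable_fun_fubini_tonelli_F => //; exact: measurable_funeneg.
Qed.

Lemma measurable_Rintegral_param_right t K : measurable_fun setT K ->
  measurable_fun setT (fun u => \int[mu]_(x in `[u, t]) K (x, u)).
Proof.
move=> mK; pose K' (z : R * R) := K (- z.2, - z.1).
have mK' : measurable_fun setT K'.
  apply: (measurableT_comp mK); apply: measurable_fun_pair.
    exact: (measurableT_comp _ measurable_snd).
  exact: (measurableT_comp _ measurable_fst).
have mv := measurable_Rintegral_param (- t) mK'.
rewrite (_ : (fun u => _) = (fun v => \int[mu]_(x in `[- t, v]) K' (v, x)) \o -%R).
  exact: (measurableT_comp mv).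
apply/funext => u /=; rewrite Rintegral_reflect.
  by apply: eq_Rintegral_itv => x _; rewrite /K'/= opprK.
exact: (measurableT_comp mK (measurable_pair2 u)).
Qed.

(** Dirichlet's formula.  For singular kernels the inner integral in u diverges
    at x = t, hence the open range of x in the domination hypothesis. *)
Lemma Rintegral_triangle s t K (G : R -> R) : measurable_fun setT K ->
  (forall x, s < x < t ->
    mu.-integrable `[s, x] (EFin \o (fun u => K (x, u))) /\
    \int[mu]_(u in `[s, x]) `|K (x, u)| <= G x) ->
  mu.-integrable `[s, t] (EFin \o G) ->
  \int[mu]_(x in `[s, t]) \int[mu]_(u in `[s, x]) K (x, u) =
  \int[mu]_(u in `[s, t]) \int[mu]_(x in `[u, t]) K (x, u).
Proof.
move=> mK iK iG; pose K' := below s t K.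
have mK' : measurable_fun setT (EFin \o K') by apply/measurable_EFinP; exact: measurable_below.
have iK' : (mu \x mu)%E.-integrable setT (EFin \o K').
  apply/integrable12ltyP => //.
  have : mu.-integrable setT ((EFin \o (fun x => `|G x|)) \_ `[s, t]).
    by apply: (iffLR (integrable_mkcond _ _)) => //; exact: (integrable_norm iG).
  move/integrableP => [mG]; apply: le_lt_trans.
  apply: ge0_le_integral => //.
  - by move=> x _; exact: integral_ge0.
  - apply: (@measurable_fun_fubini_tonelli_F _ _ _ _ _ mu (abse \o (EFin \o K'))).
      exact: measurableT_comp.
    by move=> z; exact: abse_ge0.
  - exact: measurableT_comp.
  move=> x _ /=.
  have E : (fun y => `|(K' (x, y))%:E|)%E = (fun y => (below s t (Num.norm \o K) (x, y))%:E).
    by apply/funext => u; rewrite /K' /below/=; case: ifP; rewrite ?normr0.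
  rewrite E; have [sxt|sxt] := boolP (s < x < t); last first.
    by rewrite integral_below1_out// abse_ge0.
  rewrite integral_below1//; last exact: measurableT_comp.
  have [iKx KG] := iK x sxt.
  have iKx' := integrable_norm iKx.
  rewrite patchE mem_setE in_itv/=; case: ifP => [_|]; last first.
    by case/andP : sxt => /ltW -> /ltW ->.
  rewrite /= normr_id -[leLHS]fineK; last exact: (integrable_fin_num _ iKx').
  by rewrite lee_fin (le_trans KG)// ler_norm.
have := Fubini iK'.
have -> : (\int[mu]_x \int[mu]_y (EFin \o K') (x, y) =
   \int[mu]_(x in `[s, t]) (\int[mu]_(u in `[s, x]) K (x, u))%:E)%E.
  rewrite (@integral_itv_bndoo _ _ _ _ true false); last first.
    apply/measurable_EFinP; apply: measurable_funTS; exact: measurable_Rintegral_param.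
  rewrite [RHS]integral_mkcond; apply: eq_integral => x _.
  rewrite patchE mem_setE in_itv/=; case: ifPn => [sxt|sxt]; last exact: integral_below1_out.
  rewrite integral_below1// fineK//.
  have [iKx _] := iK x sxt; exact: (integrable_fin_num _ iKx).
have mG := measurable_fubini_G iK'.
set g := (X in measurable_fun _ X) in mG.
have E2 u : s <= u -> g u = (\int[mu]_(x in `[u, t]) (K (x, u))%:E)%E.
  by move=> su; rewrite /g /fubini_G integral_below2.
have -> : (\int[mu]_y \int[mu]_x (EFin \o K') (x, y) =
   \int[mu]_(u in `[s, t]) (\int[mu]_(x in `[u, t]) K (x, u))%:E)%E.
  transitivity (\int[mu]_(u in `[s, t]) (g u))%E.
    rewrite [RHS]integral_mkcond; apply: eq_integral => u _.
    rewrite patchE mem_setE in_itv/=; case: ifPn => // /nandP[|].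
      by rewrite -ltNge => us; rewrite integral_below2_out.
    rewrite -ltNge => tu.
    have [us|su] := ltP u s; first by rewrite integral_below2_out.
    by rewrite integral_below2// set_itv_ge ?integral_set0// bnd_simp -ltNge.
  apply: ae_eq_integral => //.
  - exact: measurable_funTS.
  - apply: (@eq_measurable_fun _ _ _ _ _ (EFin \o (fine \o g))).
      by move=> u; rewrite inE/= in_itv/= => /andP[su _]; rewrite E2.
    apply: measurable_funTS; apply/measurable_EFinP.
    by apply: measurableT_comp => //; exact: fine_measurable.
  - have := ae_integrable2 iK'; apply: filterS => u iu; rewrite /= in_itv/= => /andP[su ut].
    rewrite /Rintegral -E2// fineK//; exact: integrable_fin_num iu.
by move=> E; rewrite /Rintegral E.
Qed.

End parameter_integrals.

(** * Dominated convergence on an interval *)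

Section dominated_convergence_itv.
Context {R : realType}.
Local Notation mu := (@lebesgue_measure R).

Lemma cvg_Rintegral_itv (s t : R) (F : nat -> R -> R) (f G : R -> R) :
  (forall n, measurable_fun setT (F n)) -> measurable_fun setT f ->
  (forall x, s <= x <= t -> F n x @[n --> \oo] --> f x) ->
  (forall n x, s <= x <= t -> `|F n x| <= G x) ->
  mu.-integrable `[s, t] (EFin \o G) ->
  \int[mu]_(x in `[s, t]) F n x @[n --> \oo] --> \int[mu]_(x in `[s, t]) f x.
Proof.
move=> mF mf Ff FG iG.
have [] := @dominated_convergence _ _ _ mu `[s, t] (measurable_itv _)
  (fun n => EFin \o F n) (EFin \o f) (EFin \o G).
- by move=> n; apply: measurable_funTS; apply/measurable_EFinP; exact: mF.
- by apply: measurable_funTS; exact/measurable_EFinP.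
- apply: aeW => x; rewrite /= in_itv/= => xst.
  by apply: cvg_EFin; [exact: nearW|exact: Ff].
- exact: iG.
- by apply: aeW => x n; rewrite /= in_itv/= => xst; rewrite lee_fin FG.
move=> fi _ cv; rewrite /Rintegral; apply: fine_cvg.
by rewrite fineK; last exact: (integrable_fin_num _ fi).
Qed.

End dominated_convergence_itv.

(** * The fractional derivative *)

Section fractional_derivative.
Context {R : realType}.
Local Notation mu := (@lebesgue_measure R).
Implicit Types (a s t x u C l : R) (f p : R -> R).

(** The left fractional derivative of order a started at s, without the factor
    1 / Gamma (1 - a). *)
Definition frac_deriv a s f x : R :=
  f x / (x - s) `^ a +
  a * \int[mu]_(u in `[s, x]) ((f x - f u) / (x - u) `^ (1 + a)).

Lemma measurable_frac_kernel a f : measurable_fun setT f ->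
  measurable_fun setT (fun z : R * R => (f z.1 - f z.2) / (z.1 - z.2) `^ (1 + a)).
Proof.
move=> mf; under eq_fun do rewrite -powRN.
apply: measurable_funM.
  by apply: measurable_funB; apply: (measurableT_comp mf).
by apply: (measurableT_comp (measurable_powR _)); exact: measurable_funB.
Qed.

Lemma measurable_frac_kernel1 a f x : measurable_fun setT f ->
  measurable_fun setT (fun u => (f x - f u) / (x - u) `^ (1 + a)).
Proof.
move=> mf; under eq_fun do rewrite -powRN.
apply: measurable_funM; first exact: measurable_funB.
by apply: (measurableT_comp (measurable_powR _)); exact: measurable_funB.
Qed.

Lemma measurable_frac_deriv a s f : measurable_fun setT f ->
  measurable_fun setT (frac_deriv a s f).
Proof.
move=> mf; rewrite /frac_deriv; apply: measurable_funD.
  under eq_fun do rewrite -powRN.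
  apply: measurable_funM => //; apply: (measurableT_comp (measurable_powR _)).
  exact: measurable_funB.
apply: measurable_funM => //.
exact: (measurable_Rintegral_param s (measurable_frac_kernel a mf)).
Qed.

Lemma frac_kernel_le a C l f x u : 0 <= C -> u <= x ->
  `|f x - f u| <= C * (x - u) `^ l ->
  `|(f x - f u) / (x - u) `^ (1 + a)| <= C * (x - u) `^ (l - (1 + a)).
Proof.
move=> C0; rewrite le_eqVlt => /predU1P[->|ux] fl.
  by rewrite !subrr mul0r normr0 mulr_ge0// powR_ge0.
have xu0 : 0 < x - u by rewrite subr_gt0.
rewrite powRB; last by rewrite (gt_eqF xu0) implybT.
by rewrite normrM normrV ?unitfE ?gt_eqF ?powR_gt0//
  [X in _ / X]ger0_norm ?powR_ge0// mulrA ler_pM2r// invr_gt0 powR_gt0.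
Qed.

(** The kernel is at most C (x - u)^(l - 1 - a), which is integrable since a < l. *)
Lemma frac_deriv_le a C l f s x : 0 <= C -> 0 < a < l -> s < x ->
  measurable_fun setT f ->
  (forall u, s <= u <= x -> `|f x - f u| <= C * (x - u) `^ l) ->
  `|frac_deriv a s f x| <= `|f x| * (x - s) `^ (- a) +
     C * (a * beta_int 0 (l - (1 + a))) * (x - s) `^ (l - a).
Proof.
move=> C0 /andP[a0 al] sx mf fl.
have xs0 : 0 < x - s by rewrite subr_gt0.
apply: le_trans (ler_normD _ _) _; rewrite lerD//.
  by rewrite normrM powRN normrV ?unitfE ?gt_eqF ?powR_gt0// [X in _ / X]ger0_norm ?powR_ge0.
rewrite normrM (gtr0_norm a0) mulrCA -!mulrA ler_pM2l//.
have -> : l - a = l - (1 + a) + 1 by ring.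
rewrite -Rintegral_powR_right//; last by lra.
rewrite -RintegralZl//; last by apply: integrable_powR_right; [lra|exact: ltW].
apply: ler_norm_Rintegral_itv.
- by apply: measurable_funTS; exact: measurable_frac_kernel1.
- by move=> u sux; apply: frac_kernel_le => //; [case/andP: sux|exact: fl].
- by apply: integrable_itvZl; apply: integrable_powR_right; [lra|exact: ltW].
Qed.

Lemma cvg_frac_deriv a C l s x (F : nat -> R -> R) f : 0 <= C -> a < l -> s <= x ->
  (forall n, measurable_fun setT (F n)) -> measurable_fun setT f ->
  (forall n u, s <= u <= x -> `|F n x - F n u| <= C * (x - u) `^ l) ->
  (forall u, s <= u <= x -> F n u @[n --> \oo] --> f u) ->
  frac_deriv a s (F n) x @[n --> \oo] --> frac_deriv a s f x.
Proof.
move=> C0 al sx mF mf Fl Ff.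
have xx : s <= x <= x by rewrite sx lexx.
apply: cvgD; first by apply: cvgM; [exact: Ff|exact: cvg_cst].
apply: cvgM; first exact: cvg_cst.
apply: (@cvg_Rintegral_itv _ _ _ _ _ (fun u => C * (x - u) `^ (l - (1 + a)))).
- by move=> n; exact: measurable_frac_kernel1.
- exact: measurable_frac_kernel1.
- move=> u sux; apply: cvgM; last exact: cvg_cst.
  by apply: cvgB; exact: Ff.
- by move=> n u sux; apply: frac_kernel_le => //; [case/andP: sux|exact: Fl].
- by apply: integrable_itvZl; apply: integrable_powR_right; [lra|].
Qed.

Let integrable_sing a s c x : s <= c -> c < x -> 0 < a ->
  mu.-integrable `[s, c] (EFin \o (fun u => (x - u) `^ (- (1 + a)))).
Proof.
move=> sc cx a0; apply: (@integrable_itv_bounded _ _ _ _ ((x - c) `^ (- (1 + a)))).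
  by apply: measurable_funTS; apply: (measurableT_comp (measurable_powR _)); exact: measurable_funB.
move=> u /andP[su uc]; rewrite ger0_norm ?powR_ge0// !powRN.
rewrite lef_pV2 ?posrE ?powR_gt0 ?subr_gt0//; last exact: le_lt_trans cx.
rewrite ge0_ler_powR ?nnegrE//; lra.
Qed.

Let Rintegral_sing a s c x : s <= c -> c < x -> 0 < a ->
  a * \int[mu]_(u in `[s, c]) (x - u) `^ (- (1 + a)) =
  (x - c) `^ (- a) - (x - s) `^ (- a).
Proof.
move=> sc cx a0.
have mk (e b : R) : measurable_fun setT (fun u : R => (e - u) `^ b).
  by apply: (measurableT_comp (measurable_powR _)); exact: measurable_funB.
rewrite Rintegral_reflect; last exact: mk.
have -> : `[- c, - s]%classic = `[- x + 1 * (x - c), - x + 1 * (x - s)]%classic.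
  by rewrite !mul1r !addrA !addNr !sub0r.
rewrite Rintegral_affine//; last by apply: (measurableT_comp (mk x _)).
rewrite mul1r (@eq_Rintegral_itv _ _ _ _ (fun y => y `^ (- (1 + a)))); last first.
  by move=> y _; congr (_ `^ _); ring.
rewrite /Rintegral integral_powR/=; [|lra|lra|by rewrite lt_eqF//; lra].
have -> : - (1 + a) + 1 = - a by ring.
by rewrite mulrA; field; rewrite gt_eqF.
Qed.

(** Write f x - f u as the integral of its density p over [u, x] and exchange the
    integrals: integrating (x - u)^(-1-a) over u in [s, c] leaves only the
    integrable singularity (x - c)^(-a). *)
Lemma frac_deriv_ac a s x f p P : 0 < a < 1 -> s < x ->
  measurable_fun setT p -> (forall c, `|p c| <= P) ->
  (forall u, s <= u <= x -> f x - f u = \int[mu]_(c in `[u, x]) p c) ->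
  frac_deriv a s f x =
  f s * (x - s) `^ (- a) + \int[mu]_(c in `[s, x]) (p c * (x - c) `^ (- a)).
Proof.
move=> /andP[a0 a1] sx mp pP fp.
have P0 : 0 <= P by apply: le_trans (pP 0).
have ip u v : mu.-integrable `[u, v] (EFin \o p).
  by apply: (@integrable_itv_bounded _ _ _ _ P) => //; exact: measurable_funTS.
have mk (e b : R) : measurable_fun setT (fun u : R => (e - u) `^ b).
  by apply: (measurableT_comp (measurable_powR _)); exact: measurable_funB.
pose K (z : R * R) := p z.1 * (x - z.2) `^ (- (1 + a)).
have mK : measurable_fun setT K.
  apply: measurable_funM; first exact: (measurableT_comp mp).
  by apply: (measurableT_comp (mk x _)).
have E : \int[mu]_(u in `[s, x]) ((f x - f u) / (x - u) `^ (1 + a)) =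
    \int[mu]_(u in `[s, x]) \int[mu]_(c in `[u, x]) K (c, u).
  by apply: eq_Rintegral_itv => u sux; rewrite fp// /K/= RintegralZr// -powRN.
have inner c : s <= c -> c < x ->
    \int[mu]_(u in `[s, c]) K (c, u) = p c * (a^-1 * ((x - c) `^ (- a) - (x - s) `^ (- a))).
  move=> sc cx; rewrite /K/= RintegralZl//; last exact: integrable_sing.
  by congr (_ * _); rewrite -Rintegral_sing// mulrA mulVf ?mul1r// gt_eqF.
have iG : mu.-integrable `[s, x] (EFin \o (fun c => P * (a^-1 * (x - c) `^ (- a)))).
  by do 2 apply: integrable_itvZl; apply: integrable_powR_right; lra.
rewrite /frac_deriv E -(@Rintegral_triangle _ _ _ _ _ mK _ iG); last first.
  move=> c /andP[sc cx]; split.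
    exact: (integrable_itvZl (p c) (integrable_sing (ltW sc) cx a0)).
  have -> : \int[mu]_(u in `[s, c]) `|K (c, u)| =
     `|p c| * \int[mu]_(u in `[s, c]) (x - u) `^ (- (1 + a)).
    rewrite -RintegralZl//; last exact: integrable_sing (ltW sc) cx a0.
    by apply: eq_Rintegral_itv => u _; rewrite normrM [`|_ `^ _|]ger0_norm ?powR_ge0.
  rewrite ler_pM//; first by apply: Rintegral_ge0 => u _; exact: powR_ge0.
  rewrite -(ler_pM2l a0) (Rintegral_sing (ltW sc) cx a0) mulrA mulfV ?gt_eqF// mul1r.
  by rewrite gerBl powR_ge0.
have ipk : mu.-integrable `[s, x] (EFin \o (fun c => p c * (x - c) `^ (- a))).
  apply: (@integrable_itv_le _ _ _ _ (fun c => P * (x - c) `^ (- a))).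
  - by apply: measurable_funTS; exact: measurable_funM.
  - by move=> c _; rewrite normrM [`|_ `^ _|]ger0_norm ?powR_ge0// ler_wpM2r ?powR_ge0.
  - by apply: integrable_itvZl; apply: integrable_powR_right; lra.
rewrite (@eq_Rintegral_oo _ _ _ _ (fun c => a^-1 * (p c * (x - c) `^ (- a) +
    (- (x - s) `^ (- a)) * p c))); last 3 first.
- by apply: measurable_funTS; exact: measurable_Rintegral_param.
- apply: measurable_funTS; apply: measurable_funM => //; apply: measurable_funD.
    exact: measurable_funM.
  exact: measurable_funM.
- by move=> c /andP[sc cx]; rewrite (inner _ (ltW sc) cx); ring.
rewrite RintegralZl//; last by apply: integrable_itvD => //; exact: integrable_itvZl.
rewrite RintegralD//; last exact: integrable_itvZl.
rewrite RintegralZl// -fp ?lexx ?(ltW sx)// mulrA mulfV ?gt_eqF// mul1r -powRN; ring.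
Qed.

End fractional_derivative.

(** * The integral for absolutely continuous functions *)

Section fractional_integral_ac.
Context {R : realType}.
Local Notation mu := (@lebesgue_measure R).
Implicit Types (a s t x u c C l : R) (f g p q : R -> R).

Definition ac_with f p := forall u x, u <= x -> f x - f u = \int[mu]_(c in `[u, x]) p c.

(** The right fractional derivative of g - g t at x, obtained by time reversal
    (see [rfrac_derivE]); facts on [frac_deriv] then apply to both sides. *)
Definition rfrac_deriv a t g x := frac_deriv a (- t) (fun y => g (- y) - g t) (- x).

(** The generalized Stieltjes integral of f against g, without phases and Gamma
    factors. *)
Definition frac_integral a s t f g :=
  \int[mu]_(x in `[s, t]) (frac_deriv a s f x * rfrac_deriv (1 - a) t g x).

Let mpow (e b : R) : measurable_fun setT (fun u : R => (e - u) `^ b).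
Proof. by apply: (measurableT_comp (measurable_powR _)); exact: measurable_funB. Qed.

Let mpow' (e b : R) : measurable_fun setT (fun u : R => (u - e) `^ b).
Proof. by apply: (measurableT_comp (measurable_powR _)); exact: measurable_funB. Qed.

Lemma measurable_rfrac_deriv a t g : measurable_fun setT g ->
  measurable_fun setT (rfrac_deriv a t g).
Proof.
move=> mg.
have mh : measurable_fun setT (fun y : R => g (- y) - g t).
  by apply: measurable_funB => //; exact: (measurableT_comp mg).
exact: (measurableT_comp (measurable_frac_deriv a (- t) mh)).
Qed.

Lemma frac_deriv_start a s f : a != 0 -> frac_deriv a s f s = 0.
Proof.
move=> a0; rewrite /frac_deriv subrr powR0// invr0 mulr0 add0r.
by rewrite set_itv1 Rintegral_set1 mulr0.
Qed.

Lemma rfrac_deriv_ac a t g q Q x : 0 < a < 1 -> x < t ->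
  measurable_fun setT q -> (forall c, `|q c| <= Q) -> ac_with g q ->
  rfrac_deriv a t g x = \int[mu]_(c in `[x, t]) (- q c * (c - x) `^ (- a)).
Proof.
move=> a01 xt mq qQ gq.
have mq' : measurable_fun setT (fun c : R => - q (- c)).
  by apply: measurable_funN; exact: (measurableT_comp mq).
rewrite /rfrac_deriv (@frac_deriv_ac _ _ _ _ _ (fun c => - q (- c)) Q)//; last 3 first.
- by rewrite ltrN2.
- by move=> c; rewrite normrN.
- move=> u /andP[_ ux]; rewrite opprK.
  have -> : g x - g t - (g (- u) - g t) = - (g (- u) - g x) by ring.
  rewrite gq; last by rewrite lerNr.
  rewrite Rintegral_reflect// opprK.
  rewrite -mulN1r -RintegralZl//; last first.
    apply: (@integrable_itv_bounded _ _ _ _ Q) => //.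
    by apply: measurable_funTS; exact: (measurableT_comp mq).
  by apply: eq_Rintegral_itv => c _; rewrite mulN1r.
rewrite opprK subrr mul0r add0r.
rewrite [RHS]Rintegral_reflect; last first.
  by apply: measurable_funM; [exact: measurable_funN|exact: mpow'].
by apply: eq_Rintegral_itv => c _; congr (_ * _ `^ _); ring.
Qed.

Section abel.
Variables (a s : R) (f p : R -> R) (P : R).
Hypotheses (a0 : 0 < a) (a1 : a < 1) (mp : measurable_fun setT p) (pP : forall c, `|p c| <= P).
Hypotheses (mf : measurable_fun setT f) (fp : ac_with f p).

Let a01 : 0 < a < 1. Proof. by rewrite a0. Qed.
Let na : -1 < - a. Proof. by rewrite ltrN2. Qed.
Let nb : -1 < - (1 - a). Proof. by rewrite opprB ltrBrDl subrr. Qed.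
Let P0 : 0 <= P. Proof. by apply: le_trans (pP 0). Qed.

Let mW : measurable_fun setT (frac_deriv a s f).
Proof. exact: measurable_frac_deriv. Qed.

Let k x u := p u * (x - u) `^ (- a).

Let integrable_k x : s < x -> mu.-integrable `[s, x] (EFin \o k x).
Proof.
move=> sx; apply: (@integrable_itv_le _ _ _ _ (fun u => P * (x - u) `^ (- a))).
- by apply: measurable_funTS; exact: measurable_funM.
- by move=> u _; rewrite normrM [`|_ `^ _|]ger0_norm ?powR_ge0// ler_wpM2r ?powR_ge0.
- apply: integrable_itvZl; by apply: integrable_powR_right => //; exact: ltW.
Qed.

Let Rintegral_k x : s < x ->
  \int[mu]_(u in `[s, x]) `|k x u| <= P * (beta_int 0 (- a) * (x - s) `^ (1 - a)).
Proof.
move=> sx; have -> : 1 - a = - a + 1 by ring.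
rewrite -Rintegral_powR_right//.
have ip : mu.-integrable `[s, x] (EFin \o (fun u => (x - u) `^ (- a))).
  by apply: integrable_powR_right => //; exact: ltW.
rewrite -RintegralZl//; apply: le_Rintegral_itv.
- exact: (integrable_norm (integrable_k sx)).
- exact: integrable_itvZl.
- by move=> u _; rewrite normrM [`|_ `^ _|]ger0_norm ?powR_ge0// ler_wpM2r ?powR_ge0.
Qed.

Let frac_derivE x : s < x ->
  frac_deriv a s f x = f s * (x - s) `^ (- a) + \int[mu]_(u in `[s, x]) k x u.
Proof. by move=> sx; rewrite (frac_deriv_ac a01 sx mp pP)// => u /andP[_]; exact: fp. Qed.

Let D c := P * (beta_int 0 (- a) * (c - s) `^ (1 - a)).

Let D0 c : 0 <= D c.
Proof. by rewrite !mulr_ge0 ?beta_int_ge0 ?powR_ge0. Qed.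

Let leD x c : s < x -> x <= c -> P * (beta_int 0 (- a) * (x - s) `^ (1 - a)) <= D c.
Proof.
move=> sx xc; rewrite !ler_wpM2l ?beta_int_ge0//.
by rewrite ge0_ler_powR ?nnegrE ?subr_ge0 ?(ltW a1)//; lra.
Qed.

Lemma frac_deriv_ac_le x c : s <= x -> x <= c ->
  `|frac_deriv a s f x| <= `|f s| * (x - s) `^ (- a) + D c.
Proof.
rewrite le_eqVlt => /predU1P[<- _|sx xc].
  by rewrite frac_deriv_start ?gt_eqF// normr0 addr_ge0// mulr_ge0// powR_ge0.
rewrite frac_derivE//; apply: le_trans (ler_normD _ _) _.
rewrite normrM [`|_ `^ _|]ger0_norm ?powR_ge0// lerD2l.
apply: le_trans (leD sx xc); apply: le_trans (Rintegral_k sx).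
by apply: le_normr_Rintegral => //; exact: integrable_k.
Qed.

Let integrable_majorant c : s < c ->
  mu.-integrable `[s, c] (EFin \o (fun x => `|f s| * ((x - s) `^ (- a) * (c - x) `^ (- (1 - a)))
     + D c * (c - x) `^ (- (1 - a)))).
Proof.
move=> sc; apply: integrable_itvD; apply: integrable_itvZl.
  by apply: integrable_beta => //; exact: ltW.
by apply: integrable_powR_right => //; exact: ltW.
Qed.

Lemma frac_deriv_abel_norm c x : s < c -> s <= x <= c ->
  `|frac_deriv a s f x * (c - x) `^ (- (1 - a))| <=
  `|f s| * ((x - s) `^ (- a) * (c - x) `^ (- (1 - a))) + D c * (c - x) `^ (- (1 - a)).
Proof.
move=> sc /andP[sx xc]; rewrite normrM [`|_ `^ _|]ger0_norm ?powR_ge0//.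
by rewrite mulrA -mulrDl ler_wpM2r ?powR_ge0// frac_deriv_ac_le.
Qed.

Lemma integrable_abel c : s < c ->
  mu.-integrable `[s, c] (EFin \o (fun x => frac_deriv a s f x * (c - x) `^ (- (1 - a)))).
Proof.
move=> sc; apply: integrable_itv_le (integrable_majorant sc).
  by apply: measurable_funTS; apply: (measurable_funM mW); exact: mpow.
by move=> x; exact: frac_deriv_abel_norm.
Qed.

Lemma Rintegral_abel_norm c t : s < c -> c <= t ->
  \int[mu]_(x in `[s, c]) `|frac_deriv a s f x * (c - x) `^ (- (1 - a))| <=
  `|f s| * beta_int (- a) (- (1 - a)) + D t * (beta_int 0 (- (1 - a)) * (t - s) `^ a).
Proof.
move=> sc ct.
have i1 : mu.-integrable `[s, c] (EFin \o (fun x => (x - s) `^ (- a) * (c - x) `^ (- (1 - a)))).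
  by apply: integrable_beta => //; exact: ltW.
have i2 : mu.-integrable `[s, c] (EFin \o (fun x => (c - x) `^ (- (1 - a)))).
  by apply: integrable_powR_right => //; exact: ltW.
apply: le_trans (le_Rintegral_itv (integrable_norm (integrable_abel sc)) (integrable_majorant sc) _) _.
  by move=> x; exact: frac_deriv_abel_norm.
rewrite RintegralD//; try exact: integrable_itvZl.
rewrite !RintegralZl// Rintegral_beta_conj// Rintegral_powR_right//.
apply: lerD => //.
have -> : - (1 - a) + 1 = a by ring.
rewrite ler_pM ?mulr_ge0 ?beta_int_ge0 ?powR_ge0//; first exact: leD.
by rewrite ler_wpM2l ?beta_int_ge0// ge0_ler_powR ?nnegrE ?subr_ge0 ?(ltW a0)//; lra.
Qed.

(** Abel inversion: exchanging the integrals leaves the conjugate beta integral,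
    a constant, in front of the integral of the density. *)
Lemma frac_deriv_abel c : s < c ->
  \int[mu]_(x in `[s, c]) (frac_deriv a s f x * (c - x) `^ (- (1 - a))) =
  beta_int (- a) (- (1 - a)) * f c.
Proof.
move=> sc.
pose K (z : R * R) := k z.1 z.2 * (c - z.1) `^ (- (1 - a)).
have mk : measurable_fun setT (fun z : R * R => k z.1 z.2).
  apply: measurable_funM; first exact: (measurableT_comp mp).
  by apply: (measurableT_comp (measurable_powR _)); exact: measurable_funB.
have mK : measurable_fun setT K.
  by apply: measurable_funM => //; exact: (measurableT_comp (mpow c _)).
have i2 : mu.-integrable `[s, c] (EFin \o (fun x => (c - x) `^ (- (1 - a)))).
  by apply: integrable_powR_right => //; exact: ltW.
have i1 : mu.-integrable `[s, c] (EFin \o (fun x => (x - s) `^ (- a) * (c - x) `^ (- (1 - a)))).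
  by apply: integrable_beta => //; exact: ltW.
have KE x : s < x -> \int[mu]_(u in `[s, x]) K (x, u) =
    (\int[mu]_(u in `[s, x]) k x u) * (c - x) `^ (- (1 - a)).
  by move=> sx; rewrite -RintegralZr//; exact: integrable_k.
have mint : measurable_fun setT (fun x => \int[mu]_(u in `[s, x]) K (x, u)).
  exact: (measurable_Rintegral_param s mK).
have iK : mu.-integrable `[s, c] (EFin \o (fun x => \int[mu]_(u in `[s, x]) K (x, u))).
  apply: integrable_itv_le (integrable_itvZl (D c) i2).
    exact: measurable_funTS.
  move=> x /andP[]; rewrite le_eqVlt => /predU1P[<- _|sx xc].
    by rewrite set_itv1 Rintegral_set1 normr0 mulr_ge0 ?powR_ge0.
  rewrite KE// normrM [`|_ `^ _|]ger0_norm ?powR_ge0// ler_wpM2r ?powR_ge0//.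
  apply: le_trans (leD sx xc); apply: le_trans (Rintegral_k sx).
  by apply: le_normr_Rintegral => //; exact: integrable_k.
rewrite (@eq_Rintegral_oo _ _ _ _ (fun x => f s * ((x - s) `^ (- a) * (c - x) `^ (- (1 - a))) +
    \int[mu]_(u in `[s, x]) K (x, u))); last 3 first.
- by apply: measurable_funTS; apply: (measurable_funM mW); exact: mpow.
- apply: measurable_funTS; apply: (@measurable_funD _ _ _ _ _
    (fun x => \int[mu]_(u in `[s, x]) K (x, u))); last exact: mint.
  by apply: measurable_funM => //; exact: measurable_funM.
- by move=> x /andP[sx _]; rewrite frac_derivE// KE//; ring.
rewrite RintegralD//; last exact: integrable_itvZl.
rewrite RintegralZl// Rintegral_beta_conj//.
rewrite (Rintegral_triangle mK _ (integrable_itvZl (D c) i2)); last first.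
  move=> x /andP[sx xc]; split.
    have := integrable_itvZl ((c - x) `^ (- (1 - a))) (integrable_k sx).
    by apply: eq_integrable_itv => u _; rewrite /K/= mulrC.
  rewrite (@eq_Rintegral_itv _ _ _ _ (fun u => `|k x u| * (c - x) `^ (- (1 - a)))); last first.
    by move=> u _; rewrite /K/= normrM [`|_ `^ _|]ger0_norm ?powR_ge0.
  rewrite RintegralZr//; last exact: (integrable_norm (integrable_k sx)).
  rewrite ler_wpM2r ?powR_ge0//.
  exact: le_trans (Rintegral_k sx) (leD sx (ltW xc)).
have mint2 : measurable_fun `[s, c] (fun u => \int[mu]_(x in `[u, c]) K (x, u)).
  by apply: measurable_funTS; exact: (measurable_Rintegral_param_right c mK).
rewrite (@eq_Rintegral_oo _ _ _ _ (fun u => beta_int (- a) (- (1 - a)) * p u)); last 3 first.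
- exact: mint2.
- by apply: measurable_funTS; apply: (measurable_funM (measurable_cst _) mp).
- move=> u /andP[su uc].
  rewrite (@eq_Rintegral_itv _ _ _ _ (fun x =>
    p u * ((x - u) `^ (- a) * (c - x) `^ (- (1 - a))))); last first.
    by move=> x _; rewrite /K/k/= mulrA.
  rewrite RintegralZl//; last by apply: integrable_beta => //; exact: ltW.
  by rewrite Rintegral_beta_conj// mulrC.
rewrite RintegralZl//; last first.
  by apply: (@integrable_itv_bounded _ _ _ _ P) => //; exact: measurable_funTS.
by rewrite -fp ?(ltW sc)//; ring.
Qed.

End abel.
End fractional_integral_ac.

Section frac_integral_ac.
Context {R : realType}.
Local Notation mu := (@lebesgue_measure R).
Variables (a : R) (f p g q : R -> R) (P Q : R).
Hypotheses (a0 : 0 < a) (a1 : a < 1).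
Hypotheses (mp : measurable_fun setT p) (pP : forall c, `|p c| <= P).
Hypotheses (mq : measurable_fun setT q) (qQ : forall c, `|q c| <= Q).
Hypotheses (mf : measurable_fun setT f) (fp : ac_with f p).
Hypotheses (mg : measurable_fun setT g) (gq : ac_with g q).

Let P0 : 0 <= P. Proof. by apply: le_trans (pP 0). Qed.

Let integrable_fq s t : mu.-integrable `[s, t] (EFin \o (fun c => f c * q c)).
Proof.
apply: (@integrable_itv_bounded _ _ _ _ ((`|f s| + P * (t - s)) * Q)).
  by apply: measurable_funTS; exact: measurable_funM.
move=> c /andP[sc ct]; rewrite normrM ler_pM//.
rewrite -[f c](subrK (f s)) addrC; apply: le_trans (ler_normD _ _) _.
rewrite lerD2l fp//.
apply: (@le_trans _ _ (P * (c - s))); last by rewrite ler_wpM2l// lerD2r.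
rewrite -Rintegral_itv_cst//; apply: ler_norm_Rintegral_itv => //.
- exact: measurable_funTS.
- exact: integrable_itv_cst.
Qed.

(** Insert the formula for the right derivative, exchange the integrals, and
    recover f from its left derivative by Abel inversion: what remains is a
    plain Stieltjes integral, up to the constant B(1 - a, a).  As the constant
    does not depend on [s, t], additivity follows at once. *)
Lemma frac_integral_ac s t : s < t ->
  frac_integral a s t f g =
  - beta_int (- a) (- (1 - a)) * \int[mu]_(c in `[s, t]) (f c * q c).
Proof.
move=> st.
have na1 : 0 < 1 - a < 1 by rewrite subr_gt0 a1 ltrBlDr ltrDl a0.
pose K (z : R * R) := - q z.1 * (frac_deriv a s f z.2 * (z.1 - z.2) `^ (- (1 - a))).
have mW : measurable_fun setT (frac_deriv a s f) by exact: measurable_frac_deriv.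
have mK : measurable_fun setT K.
  apply: measurable_funM; first by apply: measurable_funN; exact: (measurableT_comp mq).
  apply: measurable_funM; first exact: (measurableT_comp mW).
  by apply: (measurableT_comp (measurable_powR _)); exact: measurable_funB.
have iq u v : mu.-integrable `[u, v] (EFin \o q).
  by apply: (@integrable_itv_bounded _ _ _ _ Q) => //; exact: measurable_funTS.
have E x : x < t -> frac_deriv a s f x * rfrac_deriv (1 - a) t g x =
    \int[mu]_(c in `[x, t]) K (c, x).
  move=> xt; rewrite (rfrac_deriv_ac na1 xt mq qQ gq) -RintegralZl//.
    by apply: eq_Rintegral_itv => c _; rewrite /K/=; ring.
  apply: (@integrable_itv_le _ _ _ _ (fun c => Q * (c - x) `^ (- (1 - a)))).
  - apply: measurable_funTS; apply: measurable_funM; first exact: measurable_funN.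
    by apply: (measurableT_comp (measurable_powR _)); exact: measurable_funB.
  - move=> c _; rewrite normrM normrN [`|_ `^ _|]ger0_norm ?powR_ge0//.
    by rewrite ler_wpM2r ?powR_ge0.
  - apply: integrable_itvZl; apply: integrable_powR_left; last exact: ltW.
    by rewrite opprB ltrBrDl subrr.
have mint : measurable_fun setT (fun x => \int[mu]_(c in `[x, t]) K (c, x)).
  exact: (measurable_Rintegral_param_right t mK).
rewrite /frac_integral (@eq_Rintegral_oo _ _ _ _ (fun x => \int[mu]_(c in `[x, t]) K (c, x))); last 3 first.
- by apply: measurable_funTS; apply: (measurable_funM mW); exact: measurable_rfrac_deriv.
- exact: measurable_funTS.
- by move=> x /andP[_ xt]; exact: E.
rewrite -(@Rintegral_triangle _ s t K (fun=> Q * (`|f s| * beta_int (- a) (- (1 - a)) +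
    P * (beta_int 0 (- a) * (t - s) `^ (1 - a)) * (beta_int 0 (- (1 - a)) * (t - s) `^ a)))) //.
- rewrite (@eq_Rintegral_oo _ _ _ _ (fun c => - beta_int (- a) (- (1 - a)) * (f c * q c))).
  + by rewrite RintegralZl.
  + by apply: measurable_funTS; exact: (measurable_Rintegral_param s mK).
  + by apply: measurable_funTS; apply: measurable_funM => //; exact: measurable_funM.
  + move=> c /andP[sc ct]; rewrite /K/= RintegralZl//; last exact: (integrable_abel a0 a1 mp pP).
    by rewrite (frac_deriv_abel a0 a1 mp pP)//; ring.
- move=> c /andP[sc ct]; split.
    exact: (integrable_itvZl (- q c) (integrable_abel a0 a1 mp pP mf fp sc)).
  rewrite (@eq_Rintegral_itv _ _ _ _ (fun x =>
    `|q c| * `|frac_deriv a s f x * (c - x) `^ (- (1 - a))|)); last first.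
    by move=> x _; rewrite /K/= normrM normrN.
  rewrite RintegralZl//; last exact: (integrable_norm (integrable_abel a0 a1 mp pP mf fp sc)).
  rewrite ler_pM//; first by apply: Rintegral_ge0.
  exact: (Rintegral_abel_norm a0 a1 mp pP mf fp sc (ltW ct)).
- exact: integrable_itv_cst.
Qed.

Lemma frac_integral_ac_cat s m t : s < m < t ->
  frac_integral a s t f g = frac_integral a s m f g + frac_integral a m t f g.
Proof.
move=> /andP[sm mt]; rewrite !frac_integral_ac//; last exact: lt_trans mt.
by rewrite (@Rintegral_itv_cat _ s t m) ?mulrDr// !ltW.
Qed.

End frac_integral_ac.

(** * Sliding averages of Hoelder functions *)

Section averages.
Context {R : realType}.
Local Notation mu := (@lebesgue_measure R).
Implicit Types (C l h x u c : R) (f : R -> R).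

Definition holder C l f := forall x u, `|f x - f u| <= C * `|x - u| `^ l.

Lemma holder_ge0 C l f : holder C l f -> 0 <= C.
Proof. by move/(_ 1 0); rewrite subr0 normr1 powR1 mulr1; exact: le_trans. Qed.

Lemma holder_continuous C l f : 0 < l -> holder C l f -> continuous f.
Proof.
move=> l0 fl x; apply/cvgrPdist_le => e e0.
have C1 : 0 < C + 1 by have := holder_ge0 fl; lra.
pose dl := (e / (C + 1)) `^ l^-1.
have dl0 : 0 < dl by rewrite /dl powR_gt0// divr_gt0.
near=> u; apply: le_trans (fl x u) _.
have xu : `|x - u| <= dl.
  by apply: ltW; near: u; exact: (nbhsx_ballx x dl dl0).
apply: (@le_trans _ _ ((C + 1) * dl `^ l)).
  rewrite ler_pM ?powR_ge0// ?(holder_ge0 fl)//; first by rewrite lerDl.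
  by rewrite ge0_ler_powR ?nnegrE// ?ltW.
rewrite /dl -powRrM mulVf ?gt_eqF// powRr1; last by rewrite divr_ge0// ltW.
by rewrite mulrC divfK ?gt_eqF.
Unshelve. all: by end_near. Qed.

Lemma holder_measurable C l f : 0 < l -> holder C l f -> measurable_fun setT f.
Proof. by move=> l0 fl; apply: continuous_measurable_fun; exact: holder_continuous fl. Qed.

Definition avg h f x : R := \int[mu]_(y in `[0, 1]) f (x + h * y).

Variables (C l D : R) (f : R -> R).
Hypotheses (l0 : 0 < l) (fl : holder C l f) (fD : forall x, `|f x| <= D).

Let mf : measurable_fun setT f. Proof. exact: holder_measurable fl. Qed.

Let mfh h x : measurable_fun setT (fun y => f (x + h * y)).
Proof. by apply: (measurableT_comp mf); exact: measurable_affine. Qed.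

Let iff u v : mu.-integrable `[u, v] (EFin \o f).
Proof. by apply: (@integrable_itv_bounded _ _ _ _ D) => //; exact: measurable_funTS. Qed.

Let ifh h x : mu.-integrable `[0, 1] (EFin \o (fun y => f (x + h * y))).
Proof. by apply: (@integrable_itv_bounded _ _ _ _ D) => //; exact: measurable_funTS. Qed.

Let int01 (k : R) : \int[mu]_(y in `[0, 1]) k = k.
Proof. by rewrite Rintegral_itv_cst// subr0 mulr1. Qed.

Lemma avg_le h x : `|avg h f x| <= D.
Proof.
rewrite -[leRHS]int01; apply: ler_norm_Rintegral_itv => //.
- exact: measurable_funTS.
- exact: integrable_itv_cst.
Qed.

(** Averaging keeps the Hoelder constant, uniformly in h. *)
Lemma avg_holder h : holder C l (avg h f).
Proof.
move=> x u; rewrite /avg -RintegralB//.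
rewrite -[leRHS]int01; apply: ler_norm_Rintegral_itv => //.
- by apply: measurable_funTS; exact: measurable_funB.
- move=> y _; apply: le_trans (fl _ _) _; rewrite le_eqVlt; apply/orP; left.
  by apply/eqP; congr (_ * `|_| `^ _); ring.
- exact: integrable_itv_cst.
Qed.

Lemma avg_ac h : 0 < h -> ac_with (avg h f) (fun c => h^-1 * (f (c + h) - f c)).
Proof.
move=> h0 u x ux.
have avgE z : avg h f z = h^-1 * \int[mu]_(c in `[z, z + h]) f c.
  rewrite /avg; have := @Rintegral_affine _ z h 0 1 f h0 mf.
  by rewrite mulr0 addr0 mulr1 => ->; rewrite mulrA mulVf ?mul1r// gt_eqF.
have mfs : measurable_fun setT (fun c => f (c + h)).
  by apply: (measurableT_comp mf); exact: measurable_funD.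
have ifs : mu.-integrable `[u, x] (EFin \o (fun c => f (c + h))).
  by apply: (@integrable_itv_bounded _ _ _ _ D) => //; exact: measurable_funTS.
have shift : \int[mu]_(c in `[u, x]) f (c + h) = \int[mu]_(c in `[u + h, x + h]) f c.
  have := @Rintegral_affine _ h 1 u x f ltr01 mf.
  rewrite !mul1r [h + u]addrC [h + x]addrC => ->.
  by apply: eq_Rintegral_itv => c _; rewrite mul1r addrC.
rewrite RintegralZl//; last first.
  apply: (@integrable_itv_bounded _ _ _ _ (D + D)).
    by apply: measurable_funTS; exact: measurable_funB.
  by move=> c _; apply: le_trans (ler_normB _ _) _; exact: lerD.
rewrite RintegralB// shift !avgE -mulrBr; congr (_ * _).
have E1 : \int[mu]_(c in `[u, x + h]) f c =
    \int[mu]_(c in `[u, x]) f c + \int[mu]_(c in `[x, x + h]) f c.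
  by apply: Rintegral_itv_cat => //; lra.
have E2 : \int[mu]_(c in `[u, x + h]) f c =
    \int[mu]_(c in `[u, u + h]) f c + \int[mu]_(c in `[u + h, x + h]) f c.
  by apply: Rintegral_itv_cat => //; lra.
move: E1; rewrite E2.
move: (\int[mu]_(c in `[u, u + h]) f c) (\int[mu]_(c in `[u + h, x + h]) f c).
by move: (\int[mu]_(c in `[u, x]) f c) (\int[mu]_(c in `[x, x + h]) f c) => p q r w; lra.
Qed.

Lemma avg_slope_le h c : 0 < h -> `|h^-1 * (f (c + h) - f c)| <= h^-1 * (D + D).
Proof.
move=> h0; rewrite normrM gtr0_norm ?invr_gt0// ler_pM2l ?invr_gt0//.
by apply: le_trans (ler_normB _ _) _; exact: lerD.
Qed.

Lemma measurable_avg_slope h : measurable_fun setT (fun c => h^-1 * (f (c + h) - f c)).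
Proof.
apply: measurable_funM => //; apply: measurable_funB => //.
by apply: (measurableT_comp mf); exact: measurable_funD.
Qed.

Lemma cvg_avg x : avg n.+1%:R^-1 f x @[n --> \oo] --> f x.
Proof.
rewrite -[X in _ --> X]int01.
apply: (@cvg_Rintegral_itv _ _ _ _ _ (fun=> D)) => //.
- move=> y _.
  have h : (x + n.+1%:R^-1 * y) @[n --> \oo] --> x + 0 * y.
    by apply: cvgD; [exact: cvg_cst|apply: cvgM; [exact: cvg_harmonic|exact: cvg_cst]].
  rewrite mul0r addr0 in h; exact: (cvg_comp _ _ h (holder_continuous l0 fl (x := x))).
- exact: integrable_itv_cst.
Qed.

End averages.

(** * Additivity of the integral for Hoelder functions *)

Section additivity.
Context {R : realType}.
Local Notation mu := (@lebesgue_measure R).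
Variables (a l l' C C' D : R) (f g : R -> R).
Hypotheses (a01 : 0 < a < 1) (al : a < l) (al' : 1 - a < l').
Hypotheses (fl : holder C l f) (gl : holder C' l' g).
Hypotheses (fD : forall x, `|f x| <= D) (gD : forall x, `|g x| <= D).

Let a0 : 0 < a. Proof. by case/andP: a01. Qed.
Let a1 : a < 1. Proof. by case/andP: a01. Qed.
Let l0 : 0 < l. Proof. exact: lt_trans al. Qed.
Let l'0 : 0 < l'. Proof. by apply: lt_trans al'; rewrite subr_gt0. Qed.

Let F n := avg n.+1%:R^-1 f.
Let G n := avg n.+1%:R^-1 g.

Lemma frac_deriv_holder_le s x h : s <= x -> holder C l h -> (forall x, `|h x| <= D) ->
  `|frac_deriv a s h x| <=
  D * (x - s) `^ (- a) + C * (a * beta_int 0 (l - (1 + a))) * (x - s) `^ (l - a).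
Proof.
have D0 : 0 <= D := le_trans (normr_ge0 _) (fD 0).
have C0 := holder_ge0 fl.
move=> + hl hD; rewrite le_eqVlt => /predU1P[<-|sx].
  rewrite frac_deriv_start ?gt_eqF// normr0 addr_ge0// mulr_ge0 ?powR_ge0//.
  by rewrite !mulr_ge0 ?beta_int_ge0// ltW.
apply: le_trans (@frac_deriv_le _ a C l h s x C0 _ sx (holder_measurable l0 hl) _) _.
- by rewrite a0.
- by move=> u /andP[_ ux]; apply: le_trans (hl _ _) _; rewrite ger0_norm// subr_ge0.
by rewrite lerD2r ler_wpM2r ?powR_ge0.
Qed.

Lemma rfrac_deriv_holder_le t x h : x <= t -> holder C' l' h ->
  `|rfrac_deriv (1 - a) t h x| <=
  (C' + C' * ((1 - a) * beta_int 0 (l' - (1 + (1 - a))))) * (t - x) `^ (l' - (1 - a)).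
Proof.
have C0 := holder_ge0 gl.
have b0 : 0 < 1 - a by rewrite subr_gt0.
move=> + hl; rewrite /rfrac_deriv le_eqVlt => /predU1P[->|xt].
  rewrite frac_deriv_start ?gt_eqF// normr0 mulr_ge0 ?powR_ge0//.
  by rewrite addr_ge0// !mulr_ge0 ?beta_int_ge0// ltW.
have xt' : - t < - x by rewrite ltrN2.
have mh : measurable_fun setT (fun y : R => h (- y) - h t).
  apply: measurable_funB => //.
  exact: (measurableT_comp (holder_measurable l'0 hl)).
apply: le_trans (@frac_deriv_le _ (1 - a) C' l' _ _ _ C0 _ xt' mh _) _.
- by rewrite b0.
- move=> u /andP[_ ux].
  have -> : h (- - x) - h t - (h (- u) - h t) = h (- - x) - h (- u) by ring.
  apply: le_trans (hl _ _) _; rewrite ler0_norm; last by lra.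
  by rewrite (_ : - (- - x - - u) = - x - u)//; ring.
rewrite !opprK [- x + t]addrC [leRHS]mulrDl lerD2r.
rewrite powRB; last by rewrite (gt_eqF (_ : 0 < t - x)) ?implybT// subr_gt0.
rewrite powRN mulrA ler_wpM2r ?invr_ge0 ?powR_ge0//.
by apply: le_trans (hl _ _) _; rewrite distrC ger0_norm// subr_ge0 ltW.
Qed.

(* one integrable bound for all pairs with the given Hoelder constants *)
Let majorant s t x :=
  (C' + C' * ((1 - a) * beta_int 0 (l' - (1 + (1 - a))))) * (t - s) `^ (l' - (1 - a)) *
  (D * (x - s) `^ (- a) + C * (a * beta_int 0 (l - (1 + a))) * (t - s) `^ (l - a)).

Let integrable_majorant s t : s < t ->
  mu.-integrable `[s, t] (EFin \o majorant s t).
Proof.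
move=> st; apply: integrable_itvZl; apply: integrable_itvD; last exact: integrable_itv_cst.
by apply: integrable_itvZl; apply: integrable_powR_left; [rewrite ltrN2|exact: ltW].
Qed.

Let frac_product_le s t h k x : s <= x <= t ->
  holder C l h -> (forall x, `|h x| <= D) -> holder C' l' k ->
  `|frac_deriv a s h x * rfrac_deriv (1 - a) t k x| <= majorant s t x.
Proof.
have hal := al; have hal' := al'; have C'0 := holder_ge0 gl; have C0 := holder_ge0 fl.
have b0 : 0 < 1 - a by rewrite subr_gt0.
move=> /andP[sx xt] hl hD kl; rewrite normrM mulrC ler_pM//.
  apply: le_trans (rfrac_deriv_holder_le xt kl) _.
  apply: ler_wpM2l; first by rewrite addr_ge0// !mulr_ge0 ?beta_int_ge0// ltW.
  by apply: ge0_ler_powR; rewrite ?nnegrE; lra.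
apply: le_trans (frac_deriv_holder_le sx hl hD) _.
rewrite lerD2l; apply: ler_wpM2l; first by rewrite !mulr_ge0 ?beta_int_ge0 ?(ltW a0).
by apply: ge0_ler_powR; rewrite ?nnegrE; lra.
Qed.

Lemma integrable_frac_product s t : s < t -> mu.-integrable `[s, t]
  (EFin \o (fun x => frac_deriv a s f x * rfrac_deriv (1 - a) t g x)).
Proof.
move=> st; apply: integrable_itv_le (integrable_majorant st).
  apply: measurable_funTS; apply: measurable_funM.
    by apply: measurable_frac_deriv; exact: (holder_measurable l0 fl).
  by apply: measurable_rfrac_deriv; exact: (holder_measurable l'0 gl).
by move=> x sxt; exact: frac_product_le.
Qed.

Lemma cvg_frac_integral s t : s < t ->
  frac_integral a s t (F n) (G n) @[n --> \oo] --> frac_integral a s t f g.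
Proof.
move=> st; have C'0 := holder_ge0 gl; have C0 := holder_ge0 fl.
have mf := holder_measurable l0 fl. have mg := holder_measurable l'0 gl.
have hF n : holder C l (F n) by exact: (avg_holder l0 fl fD).
have hG n : holder C' l' (G n) by exact: (avg_holder l'0 gl gD).
have mF n := holder_measurable l0 (hF n).
have mG n := holder_measurable l'0 (hG n).
apply: (@cvg_Rintegral_itv _ _ _ _ _ (majorant s t)).
- by move=> n; apply: measurable_funM; [exact: measurable_frac_deriv|exact: measurable_rfrac_deriv].
- by apply: measurable_funM; [exact: measurable_frac_deriv|exact: measurable_rfrac_deriv].
- move=> x /andP[sx xt]; apply: cvgM.
    apply: (@cvg_frac_deriv _ _ C l) => //.
    + move=> n u /andP[_ ux]; apply: le_trans (hF n _ _) _.
      by rewrite ger0_norm// subr_ge0.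
    + by move=> u _; exact: (cvg_avg l0 fl fD).
  apply: (@cvg_frac_deriv _ _ C' l') => //.
  + by rewrite lerN2.
  + by move=> n; apply: measurable_funB => //; exact: (measurableT_comp (mG n)).
  + by apply: measurable_funB => //; exact: (measurableT_comp mg).
  + move=> n u /andP[_ ux].
    have -> : G n (- - x) - G n t - (G n (- u) - G n t) = G n (- - x) - G n (- u) by ring.
    apply: le_trans (hG n _ _) _; rewrite ler0_norm; last by lra.
    by rewrite (_ : - (- - x - - u) = - x - u)//; ring.
  + by move=> u _; apply: cvgB; exact: (cvg_avg l'0 gl gD).
- by move=> n x sxt; apply: frac_product_le => //; exact: (avg_le l0 fl fD).
- exact: integrable_majorant.
Qed.

(** Additivity passes to the limit from the sliding averages of f and g. *)
Theorem frac_integral_cat s m t : s < m < t ->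
  frac_integral a s t f g = frac_integral a s m f g + frac_integral a m t f g.
Proof.
move=> /andP[sm mt].
have cv1 := cvg_frac_integral (lt_trans sm mt).
have cv2 := cvgD (cvg_frac_integral sm) (cvg_frac_integral mt).
have -> : frac_integral a s t f g = limn (fun n => frac_integral a s t (F n) (G n)).
  by apply/esym/cvg_lim => //; exact: cv1.
have -> : frac_integral a s m f g + frac_integral a m t f g =
  limn (fun n => frac_integral a s m (F n) (G n) + frac_integral a m t (F n) (G n)).
  by apply/esym/cvg_lim => //; exact: cv2.
congr (lim (_ @ \oo)); apply/funext => n.
have h0 : 0 < n.+1%:R^-1 :> R by rewrite invr_gt0.
apply: (@frac_integral_ac_cat _ a _ _ _ _ _ _ a0 a1
  (measurable_avg_slope l0 fl _) (fun c => avg_slope_le fD c h0)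
  (measurable_avg_slope l'0 gl _) (fun c => avg_slope_le gD c h0)
  _ (avg_ac l0 fl fD h0) _ (avg_ac l'0 gl gD h0)).
- exact: holder_measurable l0 (avg_holder l0 fl fD _).
- exact: holder_measurable l'0 (avg_holder l'0 gl gD _).
- by rewrite sm.
Qed.

End additivity.

(** * From local to global increments *)

Section chaining.
Context {R : realType}.
Variables (b c1 c2 lam A0 t1 t2 : R) (X : R -> R).
Hypotheses (b0 : 0 < b) (c1_gt0 : 0 < c1) (c2_gt0 : 0 < c2) (lam0 : 0 < lam).
Hypothesis t12 : t1 < t2.

Definition holder_on A s t :=
  forall u v, s <= u -> u <= v -> v <= t -> `|X v - X u| <= A * (v - u) `^ b.

Hypothesis A0_ge0 : 0 <= A0.
Hypothesis XA0 : holder_on A0 t1 t2.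
Hypothesis X_loc : forall s t A, t1 <= s -> s < t -> t <= t2 -> 0 <= A ->
  holder_on A s t ->
  `|X t - X s| <= lam * (c1 * (t - s) `^ b + c2 * A * (t - s) `^ (2 * b)).

(** The length for which c2 * lam * mesh `^ b = 1 / 2. *)
Definition mesh := (2 * c2 * lam) `^ (- b^-1).

Let w0 : 0 < 2 * c2 * lam. Proof. by rewrite !mulr_gt0. Qed.

Let mesh_gt0 : 0 < mesh. Proof. exact: powR_gt0. Qed.

Let meshb : mesh `^ b = (2 * c2 * lam)^-1.
Proof. by rewrite /mesh -powRrM mulNr mulVf ?gt_eqF// powR_inv1// ltW. Qed.

(** Half of the Hoelder constant is absorbed on intervals no longer than [mesh]. *)
Lemma holder_bootstrap s t A : t1 <= s -> t <= t2 -> t - s <= mesh -> 0 <= A ->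
  holder_on A s t -> holder_on (lam * c1 + A / 2) s t.
Proof.
move=> t1s tt2 tsm A_ge0 XA u v su; rewrite le_eqVlt => /predU1P[<- _|uv vt].
  rewrite subrr normr0 mulr_ge0 ?powR_ge0// addr_ge0 ?divr_ge0//.
  by rewrite mulr_ge0// ltW.
have XA' : holder_on A u v.
  by move=> u' v' uu' u'v' v'v; apply: XA => //; [exact: le_trans uu'|exact: le_trans vt].
apply: le_trans (X_loc (le_trans t1s su) uv (le_trans vt tt2) A_ge0 XA') _.
have vu0 : 0 < v - u by rewrite subr_gt0.
rewrite mulr2n mulrDl !mul1r powRD; last by rewrite (gt_eqF vu0) implybT.
have le1 : (v - u) `^ b <= (2 * c2 * lam)^-1.
  rewrite -meshb; apply: ge0_ler_powR; rewrite ?nnegrE ?(ltW b0) ?(ltW vu0) ?(ltW mesh_gt0)//.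
  by apply: le_trans tsm; exact: lerB.
rewrite mulrA -mulrDl mulrA ler_wpM2r ?powR_ge0// mulrDr lerD2l.
have -> : A / 2 = lam * (c2 * A * (2 * c2 * lam)^-1).
  by field; rewrite !gt_eqF.
rewrite ler_wpM2l// ?(ltW lam0)//.
by rewrite ler_wpM2l// mulr_ge0// ltW.
Qed.

(** Iterating the bootstrap from A0 gives the constants
    2 lam c1 + A0 / 2^n for all n. *)
Lemma holder_short s t : t1 <= s -> t <= t2 -> t - s <= mesh ->
  holder_on (2 * (lam * c1)) s t.
Proof.
move=> t1s tt2 tsm.
have E n : holder_on (2 * (lam * c1) + A0 / 2 ^+ n) s t.
  elim: n => [|n IH].
    rewrite expr0 divr1 => u v su uv vt.
    apply: le_trans (XA0 (le_trans t1s su) uv (le_trans vt tt2)) _.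
    rewrite ler_wpM2r ?powR_ge0// lerDr.
    by do 2 (rewrite mulr_ge0//; try exact: ltW).
  have -> : 2 * (lam * c1) + A0 / 2 ^+ n.+1 = lam * c1 + (2 * (lam * c1) + A0 / 2 ^+ n) / 2.
    by rewrite exprS; field; rewrite expf_neq0.
  apply: holder_bootstrap => //.
  by rewrite addr_ge0 ?divr_ge0 ?exprn_ge0// !mulr_ge0// ltW.
move=> u v su uv vt.
have cv : (2 * (lam * c1) + A0 / 2 ^+ n) * (v - u) `^ b @[n --> \oo] -->
    (2 * (lam * c1) + A0 * 0) * (v - u) `^ b.
  apply: cvgM; last exact: cvg_cst.
  apply: cvgD; first exact: cvg_cst.
  apply: cvgM; first exact: cvg_cst.
  rewrite (_ : (fun n => _) = (fun n => (2^-1 : R) ^+ n)).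
    by apply: cvg_expr; rewrite ger0_norm ?invr_ge0// invf_lt1// ltr1n.
  by apply/funext => n; rewrite exprVn.
rewrite mulr0 addr0 in cv; rewrite -(cvg_lim _ cv)//.
apply: limr_ge; first by apply/cvg_ex; eexists; exact: cv.
by apply: nearW => n; exact: E.
Qed.

Lemma chaining (n : nat) d : 0 < d -> d <= mesh -> t1 + n%:R * d <= t2 ->
  `|X (t1 + n%:R * d) - X t1| <= n%:R * (2 * (lam * c1) * d `^ b).
Proof.
move=> d0 dm; elim: n => [|n IH] nt2; first by rewrite !mul0r addr0 subrr normr0.
have E : t1 + n.+1%:R * d = t1 + n%:R * d + d by rewrite -natr1; ring.
have nt : t1 + n%:R * d <= t2 by apply: le_trans nt2; rewrite E lerDl ltW.
rewrite (_ : _ - X t1 = (X (t1 + n%:R * d) - X t1) +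
  (X (t1 + n.+1%:R * d) - X (t1 + n%:R * d))); last by ring.
rewrite -[in leRHS]natr1 mulrDl mul1r.
apply: le_trans (ler_normD _ _) _; apply: lerD; first exact: IH.
rewrite E in nt2 *.
have := @holder_short (t1 + n%:R * d) (t1 + n%:R * d + d) _ nt2 _ _ _ (lexx _) _ (lexx _).
rewrite [_ + d - _]addrC addKr; apply.
- by rewrite lerDl mulr_ge0// ltW.
- exact: dm.
- by rewrite lerDl ltW.
Qed.

(** The number n of steps is chosen with r <= n <= r + 1, where r counts meshes;
    the summand r produces the term in lam `^ b^-1 and the summand 1 the other. *)
Theorem increment_le :
  `|X t2 - X t1| <= (2 * c1 + c1 / c2 * (2 * c2) `^ b^-1) *
     (lam * (t2 - t1) `^ b + lam `^ b^-1 * (t2 - t1)).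
Proof.
have tt0 : 0 < t2 - t1 by rewrite subr_gt0.
pose r := (t2 - t1) / mesh.
have r0 : 0 < r by rewrite divr_gt0.
pose n := (Num.trunc r).+1.
have n0 : 0 < n%:R :> R by rewrite ltr0n.
have rn : r <= n%:R by exact/ltW/truncnS_gt.
have nr : n%:R <= r + 1 by rewrite /n -natr1 lerD2r truncn_le// ltW.
pose d := (t2 - t1) / n%:R.
have d0 : 0 < d by rewrite divr_gt0.
have dm : d <= mesh by rewrite /d ler_pdivrMr// mulrC -ler_pdivrMr.
have dt : d <= t2 - t1 by rewrite /d ler_pdivrMr// ler_peMr ?(ltW tt0)// ler1n.
have t2E : t1 + n%:R * d = t2.
  by rewrite /d mulrC divfK ?gt_eqF// addrC subrK.
have := @chaining n d d0 dm; rewrite t2E => /(_ (lexx _)) le0.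
apply: le_trans le0 _.
set k := 2 * (lam * c1).
have k0 : 0 < k by rewrite !mulr_gt0.
have db : d `^ b <= mesh `^ b by rewrite ge0_ler_powR ?nnegrE ?(ltW b0) ?(ltW d0) ?(ltW mesh_gt0).
have db' : d `^ b <= (t2 - t1) `^ b by rewrite ge0_ler_powR ?nnegrE ?(ltW b0) ?(ltW d0) ?(ltW tt0).
have le1 : n%:R * (k * d `^ b) <= k * (r * mesh `^ b + (t2 - t1) `^ b).
  rewrite mulrCA ler_pM2l//.
  apply: (@le_trans _ _ ((r + 1) * d `^ b)); first by rewrite ler_wpM2r ?powR_ge0.
  by rewrite mulrDl mul1r lerD// ler_wpM2l// ltW.
apply: le_trans le1 _.
have meshV : mesh^-1 = (2 * c2) `^ b^-1 * lam `^ b^-1.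
  by rewrite /mesh powRN invrK powRM// ltW// mulr_gt0.
have -> : k * (r * mesh `^ b + (t2 - t1) `^ b) =
  c1 / c2 * (2 * c2) `^ b^-1 * (lam `^ b^-1 * (t2 - t1)) + 2 * c1 * (lam * (t2 - t1) `^ b).
  by rewrite /r meshV meshb /k; field; rewrite !gt_eqF.
set g := c1 / c2 * _; set p := lam * _; set q := lam `^ _ * _.
have g0 : 0 <= g by rewrite !mulr_ge0 ?powR_ge0 ?invr_ge0// ltW.
have p0 : 0 <= p by rewrite mulr_ge0 ?powR_ge0 ?(ltW lam0).
have q0 : 0 <= q by rewrite mulr_ge0 ?powR_ge0 ?(ltW tt0).
rewrite (_ : (2 * c1 + g) * (p + q) = (g * q + 2 * c1 * p) + (g * p + 2 * c1 * q)); last by ring.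
have c1_ge0 : 0 <= 2 * c1 by rewrite mulr_ge0// ltW.
by rewrite lerDl; apply: addr_ge0; apply: mulr_ge0.
Qed.

End chaining.

(** * The integral against a kernel with a power bound *)

Section local_estimate.
Context {R : realType}.
Local Notation mu := (@lebesgue_measure R).

(** The two terms bounding the fractional derivative of f ([frac_deriv_le]) meet
    the power bound on V in two beta integrals, of total degree b and 2 b. *)
Lemma frac_integral_local_le (a b s t K A lam : R) (f V : R -> R) :
  0 < a < b -> a < 1 -> s < t -> 0 <= K -> 0 <= A -> 0 <= lam ->
  measurable_fun setT f -> measurable_fun setT V ->
  (forall x, s <= x <= t -> `|f x| <= K) ->
  (forall u x, s <= u -> u <= x -> x <= t -> `|f x - f u| <= A * (x - u) `^ b) ->
  (forall x, s <= x <= t -> `|V x| <= lam * (t - x) `^ (b + a - 1)) ->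
  `|\int[mu]_(x in `[s, t]) (frac_deriv a s f x * V x)| <=
  lam * (K * beta_int (- a) (b + a - 1) * (t - s) `^ b +
    A * (a * beta_int 0 (b - (1 + a))) * beta_int (b - a) (b + a - 1) * (t - s) `^ (2 * b)).
Proof.
move=> /andP[a0 ab] a1 st K0 A0 lam0 mf mV fK fA Vlam.
set c := A * (a * _).
have c0 : 0 <= c by rewrite !mulr_ge0 ?beta_int_ge0// ltW.
pose maj x := lam * (K * ((x - s) `^ (- a) * (t - x) `^ (b + a - 1)) +
   c * ((x - s) `^ (b - a) * (t - x) `^ (b + a - 1))).
have i1 : mu.-integrable `[s, t] (EFin \o (fun x => (x - s) `^ (- a) * (t - x) `^ (b + a - 1))).
  by apply: integrable_beta; lra.
have i2 : mu.-integrable `[s, t] (EFin \o (fun x => (x - s) `^ (b - a) * (t - x) `^ (b + a - 1))).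
  by apply: integrable_beta; lra.
have i12 : mu.-integrable `[s, t] (EFin \o (fun x =>
    K * ((x - s) `^ (- a) * (t - x) `^ (b + a - 1)) +
    c * ((x - s) `^ (b - a) * (t - x) `^ (b + a - 1)))).
  by apply: integrable_itvD; exact: integrable_itvZl.
have imaj : mu.-integrable `[s, t] (EFin \o maj) by exact: integrable_itvZl.
apply: (@le_trans _ _ (\int[mu]_(x in `[s, t]) maj x)); last first.
  rewrite le_eqVlt; apply/orP; left; apply/eqP.
  rewrite RintegralZl// RintegralD//; [|exact: integrable_itvZl..].
  rewrite !RintegralZl// !Rintegral_beta//; try lra.
  have -> : - a + (b + a - 1) + 1 = b by ring.
  have -> : b - a + (b + a - 1) + 1 = 2 * b by ring.
  by congr (_ * _); rewrite !mulrA.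
apply: ler_norm_Rintegral_itv => //.
  by apply: measurable_funTS; apply: measurable_funM => //; exact: measurable_frac_deriv.
move=> x /andP[sx xt]; rewrite normrM.
have -> : maj x = (K * (x - s) `^ (- a) + c * (x - s) `^ (b - a)) *
    (lam * (t - x) `^ (b + a - 1)) by rewrite /maj; ring.
apply: ler_pM => //; last by apply: Vlam; rewrite sx.
move: sx; rewrite le_eqVlt => /predU1P[<-|sx].
  by rewrite frac_deriv_start ?gt_eqF// normr0 addr_ge0// mulr_ge0// powR_ge0.
apply: le_trans (@frac_deriv_le _ a A b f s x A0 _ sx mf _) _.
- by rewrite a0.
- by move=> u /andP[su ux]; exact: fA.
by rewrite lerD2r ler_wpM2r ?powR_ge0// fK// (ltW sx).
Qed.

End local_estimate.

(** * Real form of the complex integral *)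

Section phases.
Local Open Scope complex_scope.
Context {R : realType}.
Local Notation mu := (@lebesgue_measure R).
Implicit Types (a s t x : R) (f g F G : R -> R).

Lemma left_derivE a s t f F x : s <= x <= t ->
  (forall u, s <= u <= t -> f u = F u) ->
  left_deriv a s f x = (Gamma (1 - a))^-1 * frac_deriv a s F x.
Proof.
move=> /andP[sx xt] fF; rewrite /left_deriv /frac_deriv; congr (_ * (_ / _ + _ * _)).
  by rewrite fF// sx.
apply: eq_Rintegral_itv => u /andP[su ux]; rewrite /left_kernel.
by rewrite !fF ?su ?sx// (le_trans ux).
Qed.

Lemma rfrac_derivE b t G x : measurable_fun setT G ->
  rfrac_deriv b t G x = (G x - G t) / (t - x) `^ b +
    b * \int[mu]_(u in `[x, t]) ((G x - G u) / (u - x) `^ (1 + b)).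
Proof.
move=> mG.
have mk : measurable_fun setT (fun u => (G x - G u) / (u - x) `^ (1 + b)).
  under eq_fun do rewrite -powRN.
  apply: measurable_funM; first exact: measurable_funB.
  by apply: (measurableT_comp (measurable_powR _)); exact: measurable_funB.
rewrite (Rintegral_reflect x t mk) /rfrac_deriv /frac_deriv.
have -> : - x - - t = t - x by rewrite opprK addrC.
have I : \int[mu]_(u in `[- t, - x]) ((G x - G t - (G (- u) - G t)) / (- x - u) `^ (1 + b)) =
    \int[mu]_(u in `[- t, - x]) ((G x - G (- u)) / (- u - x) `^ (1 + b)).
  apply: eq_Rintegral_itv => u _; rewrite [- x - u]addrC.
  by have -> : G x - G t - (G (- u) - G t) = G x - G (- u) by ring.
by rewrite opprK I.
Qed.

Lemma right_derivE a s t g G x : s <= x <= t -> measurable_fun setT G ->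
  (forall u, s <= u <= t -> g u = G u) ->
  right_deriv a t (shift_end g t) x =
  expi (- (pi * a)) * ((Gamma a)^-1 * rfrac_deriv (1 - a) t G x)%:C.
Proof.
move=> /andP[sx xt] mG gG; have st := le_trans sx xt.
have gx : g x = G x by apply: gG; rewrite sx.
have gt : g t = G t by apply: gG; rewrite st lexx.
have ker : \int[mu]_(u in `[x, t]) right_kernel a (shift_end g t) x u =
    \int[mu]_(u in `[x, t]) ((G x - G u) / (u - x) `^ (1 + (1 - a))).
  apply: eq_Rintegral_itv => u /andP[xu ut]; rewrite /right_kernel /shift_end.
  rewrite gx gt (gG u); last by rewrite ut (le_trans sx xu).
  have -> : G x - G t - (G u - G t) = G x - G u by ring.
  by have -> : 2 - a = 1 + (1 - a) by ring.
have E : shift_end g t x / (t - x) `^ (1 - a) +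
    (1 - a) * \int[mu]_(u in `[x, t]) right_kernel a (shift_end g t) x u =
    rfrac_deriv (1 - a) t G x.
  by rewrite ker rfrac_derivE// /shift_end gx gt.
by rewrite /right_deriv E -mulrA -fmorphV -rmorphM.
Qed.

Lemma expiN (theta : R) : expi theta * expi (- theta) = 1.
Proof.
rewrite /expi cosN sinN; simpc; rewrite -!expr2 cos2Dsin2.
by rewrite [sin theta * _]mulrC addNr.
Qed.

Lemma normc_expi (theta : R) : ComplexField.Normc.normc (expi theta) = 1.
Proof. by rewrite /expi/= cos2Dsin2 sqrtr1. Qed.

(** A constant phase factors out of the integral of its real and imaginary parts. *)
Lemma Cintegral_phase s t (c : R[i]) (h : R -> R) (f : R -> R[i]) :
  mu.-integrable `[s, t] (EFin \o h) ->
  (forall x, s <= x <= t -> f x = c * (h x)%:C) ->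
  Cintegral `[s, t] f = c * (\int[mu]_(x in `[s, t]) h x)%:C.
Proof.
move=> ih fE; rewrite /Cintegral.
rewrite (@eq_Rintegral_itv _ _ _ _ (fun x => complex.Re c * h x)); last first.
  by move=> x /fE ->; case: (c) => c1 c2 /=; rewrite mulr0 subr0.
rewrite (@eq_Rintegral_itv _ _ _ (fun x => complex.Im (f x)) (fun x => complex.Im c * h x)); last first.
  by move=> x /fE ->; case: (c) => c1 c2 /=; rewrite mulr0 add0r.
rewrite !RintegralZl//; case: (c) => c1 c2 /=.
by simpc.
Qed.

(** The phases of the integral and of the right derivative cancel, so the integral
    is real.  F and G extend f and g from [s, t] to measurable functions on the
    line. *)
Lemma gls_integralE a s t f g F G : s <= t -> measurable_fun setT G ->
  (forall u, s <= u <= t -> f u = F u) -> (forall u, s <= u <= t -> g u = G u) ->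
  mu.-integrable `[s, t] (EFin \o (fun x => frac_deriv a s F x * rfrac_deriv (1 - a) t G x)) ->
  gls_integral a s t f g =
  ((Gamma (1 - a))^-1 * (Gamma a)^-1 * frac_integral a s t F G)%:C.
Proof.
move=> st mG fF gG iFG; rewrite /gls_integral.
rewrite (@Cintegral_phase _ _ (expi (- (pi * a)))
  (fun x => (Gamma (1 - a))^-1 * (Gamma a)^-1 * (frac_deriv a s F x * rfrac_deriv (1 - a) t G x))).
- by rewrite mulrA expiN mul1r RintegralZl.
- exact: integrable_itvZl.
- move=> x sxt; rewrite (left_derivE _ sxt fF) (right_derivE _ sxt mG gG).
  by rewrite mulrCA -rmorphM/=; congr (_ * _%:C); ring.
Qed.

Lemma normc_Zfun a s t g G x : s <= x <= t -> measurable_fun setT G ->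
  (forall u, s <= u <= t -> g u = G u) ->
  ComplexField.Normc.normc (Zfun a g x t) = `|(Gamma a)^-1 * rfrac_deriv (1 - a) t G x|.
Proof.
move=> sxt mG gG; rewrite /Zfun (right_derivE _ sxt mG gG).
rewrite ComplexField.Normc.normcM normc_expi mul1r/=.
by rewrite expr0n/= addr0 sqrtr_sqr.
Qed.

End phases.

(** * Paths restricted to a bounded time interval *)

Section clamp.
Context {R : realType}.
Implicit Types (T u v g : R) (f : R -> R).

(** Composing a path with [clamp T] leaves it unchanged on [0, T] and makes a
    local Hoelder property global, so that measurability and Hoelder bounds hold
    on the whole line. *)
Definition clamp T u : R := Num.max 0 (Num.min u T).

Lemma clamp_itv T u : 0 <= T -> 0 <= clamp T u <= T.
Proof.
move=> T0; rewrite /clamp le_max lexx/= ge_max T0/=.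
by rewrite ge_min lexx orbT.
Qed.

Lemma clamp_id T u : 0 <= u <= T -> clamp T u = u.
Proof. by move=> /andP[u0 uT]; rewrite /clamp min_l// max_r. Qed.

Lemma clamp_contract T u v : `|clamp T u - clamp T v| <= `|u - v|.
Proof.
have h1 : u - v <= `|u - v| by exact: ler_norm.
have h2 : v - u <= `|u - v| by rewrite distrC ler_norm.
rewrite /clamp ler_norml; apply/andP.
case: (leP u T) => ?; case: (leP v T) => ?;
  repeat match goal with |- context [Num.max 0 ?z] => case: (leP 0 z) => ? end; split; lra.
Qed.

Lemma holder_clamp T g f : 0 < T -> 0 < g -> locally_holder g f ->
  exists C, holder C g (f \o clamp T).
Proof.
move=> T0 g0 /(_ T T0)[C fC]; exists `|C| => u v /=.
have cT w := clamp_itv w (ltW T0).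
apply: le_trans (fC _ _ (cT u) (cT v)) _.
apply: (@le_trans _ _ (`|C| * `|clamp T u - clamp T v| `^ g)).
  by rewrite ler_wpM2r ?powR_ge0// ler_norm.
by rewrite ler_wpM2l// ge0_ler_powR ?nnegrE ?(ltW g0)// clamp_contract.
Qed.

Lemma clamp_bounded T C g f : 0 < T -> 0 < g -> holder C g (f \o clamp T) ->
  exists D, forall u, `|f (clamp T u)| <= D.
Proof.
move=> T0 g0 fC; exists (`|f 0| + C * T `^ g) => u.
have [cu0 cuT] := andP (clamp_itv u (ltW T0)).
have c0 : clamp T 0 = 0 by apply: clamp_id; rewrite lexx ltW.
have cc : clamp T (clamp T u) = clamp T u by apply: clamp_id; exact: clamp_itv (ltW T0).
have := fC (clamp T u) 0; rewrite /= c0 cc subr0 => h.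
rewrite -[f (clamp T u)](subrK (f 0)) addrC.
apply: le_trans (ler_normD _ _) _; rewrite lerD2l; apply: le_trans h _.
rewrite ler_wpM2l ?(holder_ge0 fC)// ge0_ler_powR ?nnegrE ?(ltW g0) ?(ltW T0)//.
by rewrite ger0_norm.
Qed.

End clamp.

(** * Increments of the solution on short intervals *)

Section solution_path.
Local Open Scope complex_scope.
Context {R : realType}.
Local Notation mu := (@lebesgue_measure R).
Variables (H alpha beta K L x0 : R) (a b x y : R -> R).
Hypotheses (H_range : 2^-1 < H < 1) (alpha_range : 1 - H < alpha < 2^-1).
Hypotheses (beta_range : 2^-1 < beta < H).
Hypotheses (ab_le : forall z, `|a z| + `|b z| <= K).
Hypotheses (ab_lip : forall z w, `|a z - a w| + `|b z - b w| <= L * `|z - w|).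
Hypotheses (hx : holder_below H x) (hy : holder_below H y).
Hypothesis x_eq : forall t, 0 <= t ->
  (x t)%:C = (x0 + \int[mu]_(s in `[0, t]) a (x s))%:C +
    gls_integral alpha 0 t (fun s => b (x s)) y.
Hypothesis K_gt0 : 0 < K.
Hypothesis L_gt0 : 0 < L.

Let c := (Gamma (1 - alpha))^-1 * (Gamma alpha)^-1.

Section horizon.
Variable T : R.
Hypothesis T0 : 0 < T.

Let A u := a (x (clamp T u)).
Let F u := b (x (clamp T u)).
Let G u := y (clamp T u).
(* a Hoelder exponent of the driver in ]1 - alpha, H[ *)
Let g := (1 - alpha + H) / 2.

Let alpha01 : 0 < alpha < 1.
Proof. move: H_range alpha_range => /andP[? ?] /andP[? ?]; apply/andP; split; lra. Qed.
Let alphabeta : alpha < beta.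
Proof. move: beta_range alpha_range => /andP[? ?] /andP[? ?]; lra. Qed.
Let alphag : 1 - alpha < g.
Proof. move: beta_range alpha_range => /andP[? ?] /andP[? ?]; rewrite /g; lra. Qed.
Let g_range : 0 < g < H.
Proof.
move: H_range alpha_range => /andP[? ?] /andP[? ?]; rewrite /g; apply/andP; split; lra.
Qed.
Let betaH : 0 < beta < H.
Proof. move: beta_range => /andP[? ?]; apply/andP; split; lra. Qed.
Let beta0 : 0 < beta. Proof. by case/andP: betaH. Qed.
Let g0 : 0 < g. Proof. by case/andP: g_range. Qed.

Lemma clamped_path : exists C, holder C beta (x \o clamp T).
Proof. exact: holder_clamp T0 beta0 (hx betaH). Qed.

Let comp_lip h : (forall z w, `|h z - h w| <= L * `|z - w|) ->
  exists C, holder C beta (fun u => h (x (clamp T u))).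
Proof.
move=> hL; have [C xC] := clamped_path; exists (L * C) => u v.
by apply: le_trans (hL _ _) _; rewrite -mulrA ler_wpM2l ?(ltW L_gt0)//; exact: xC.
Qed.

Let a_lip z w : `|a z - a w| <= L * `|z - w|.
Proof. by apply: le_trans (ab_lip z w); rewrite lerDl. Qed.
Let b_lip z w : `|b z - b w| <= L * `|z - w|.
Proof. by apply: le_trans (ab_lip z w); rewrite lerDr. Qed.
Let a_le z : `|a z| <= K.
Proof. by apply: le_trans (ab_le z); rewrite lerDl. Qed.
Let b_le z : `|b z| <= K.
Proof. by apply: le_trans (ab_le z); rewrite lerDr. Qed.

Let mA : measurable_fun setT A.
Proof. have [C hA] := comp_lip a_lip; exact: holder_measurable beta0 hA. Qed.
Let mF : measurable_fun setT F.
Proof. have [C hF] := comp_lip b_lip; exact: holder_measurable beta0 hF. Qed.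
Let mG : measurable_fun setT G.
Proof. have [C hG] := holder_clamp T0 g0 (hy g_range); exact: holder_measurable g0 hG. Qed.

Let iA s t : mu.-integrable `[s, t] (EFin \o A).
Proof.
apply: (@integrable_itv_bounded _ _ _ _ K); first exact: measurable_funTS.
by move=> u _; exact: a_le.
Qed.

Let integrable_FG s t : s < t -> mu.-integrable `[s, t]
  (EFin \o (fun u => frac_deriv alpha s F u * rfrac_deriv (1 - alpha) t G u)).
Proof.
move=> st; have [C hF] := comp_lip b_lip.
have [C' hG] := holder_clamp T0 g0 (hy g_range).
have [D bG] := clamp_bounded T0 g0 hG.
have bF u : `|F u| <= Num.max K D by rewrite le_max b_le.
exact: (integrable_frac_product alpha01 alphabeta alphag hF hG bF).
Qed.

Let frac_integral_FG_cat s m t : s < m < t ->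
  frac_integral alpha s t F G = frac_integral alpha s m F G + frac_integral alpha m t F G.
Proof.
have [C hF] := comp_lip b_lip.
have [C' hG] := holder_clamp T0 g0 (hy g_range).
have [D bG] := clamp_bounded T0 g0 hG.
have bF u : `|F u| <= Num.max K D by rewrite le_max b_le.
have bG' u : `|G u| <= Num.max K D by rewrite le_max bG orbT.
exact: (frac_integral_cat alpha01 alphabeta alphag hF hG bF bG').
Qed.

Let xE t : 0 < t -> t <= T ->
  x t = x0 + \int[mu]_(s in `[0, t]) A s + c * frac_integral alpha 0 t F G.
Proof.
move=> t0 tT; have := x_eq (ltW t0).
have idt u : 0 <= u <= t -> clamp T u = u.
  by move=> /andP[u0 ut]; apply: clamp_id; rewrite u0 (le_trans ut).
rewrite (@gls_integralE _ alpha 0 t _ _ F G (ltW t0) mG _ _ (integrable_FG t0)); last 2 first.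
- by move=> u ut; rewrite /F idt.
- by move=> u ut; rewrite /G idt.
rewrite (@eq_Rintegral_itv _ _ _ (fun s => a (x s)) A); last by move=> u ut; rewrite /A idt.
by rewrite -rmorphD => /(congr1 (@complex.Re R)).
Qed.

Let x_start : x 0 = x0.
Proof.
have := x_eq (lexx 0); rewrite /gls_integral /Cintegral set_itv1 !Rintegral_set1.
by rewrite !addr0 mulr0 addr0 => /(congr1 (@complex.Re R)).
Qed.

(** The equation on [0, s] and on [0, t], with the additivity of both integrals. *)
Lemma increment_eq s t : 0 <= s -> s < t -> t <= T ->
  x t - x s = \int[mu]_(u in `[s, t]) A u + c * frac_integral alpha s t F G.
Proof.
rewrite le_eqVlt => /predU1P[<-|s0] st tT; first by rewrite (xE st tT) x_start; ring.
rewrite (xE (lt_trans s0 st) tT) (xE s0 (le_trans (ltW st) tT)).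
rewrite (@frac_integral_FG_cat 0 s t) ?s0//.
rewrite (@Rintegral_itv_cat _ 0 t s) ?(ltW s0) ?(ltW st)//.
move: (\int[mu]_(u in `[0, s]) A u) (\int[mu]_(u in `[s, t]) A u) => p q.
by move: (frac_integral _ 0 s _ _) (frac_integral _ s t _ _) => p' q'; ring.
Qed.

Let g1 := `|(Gamma (1 - alpha))^-1|.

Lemma increment_local lam B s t : 0 <= s -> s < t -> t <= T -> 0 <= lam -> 0 <= B ->
  (forall u, s <= u < t ->
    ComplexField.Normc.normc (Zfun alpha y u t) <= lam * (t - u) `^ (beta + alpha - 1)) ->
  holder_on beta x B s t ->
  `|x t - x s| <= K * (t - s) + g1 * (lam *
    (K * beta_int (- alpha) (beta + alpha - 1) * (t - s) `^ beta +
     L * B * (alpha * beta_int 0 (beta - (1 + alpha))) *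
       beta_int (beta - alpha) (beta + alpha - 1) * (t - s) `^ (2 * beta))).
Proof.
move=> s0 st tT lam0 B0 Zlam xB.
have [alpha0 alpha1] := andP alpha01.
have idt u : s <= u -> u <= t -> clamp T u = u.
  by move=> su ut; apply: clamp_id; rewrite (le_trans s0)// (le_trans ut).
rewrite (increment_eq s0 st tT); apply: le_trans (ler_normD _ _) _; apply: lerD.
  rewrite -Rintegral_itv_cst ?(ltW st)//; apply: ler_norm_Rintegral_itv.
  - exact: measurable_funTS.
  - by move=> u _; exact: a_le.
  - exact: integrable_itv_cst.
pose V u := (Gamma alpha)^-1 * rfrac_deriv (1 - alpha) t G u.
have mV : measurable_fun setT V.
  by apply: (measurable_funM (measurable_cst _)); exact: measurable_rfrac_deriv.
have -> : c * frac_integral alpha s t F G =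
    (Gamma (1 - alpha))^-1 * \int[mu]_(u in `[s, t]) (frac_deriv alpha s F u * V u).
  rewrite /c -mulrA; congr (_ * _); rewrite -RintegralZl//; last exact: integrable_FG.
  by apply: eq_Rintegral_itv => u _; rewrite mulrCA.
rewrite normrM ler_wpM2l//.
apply: frac_integral_local_le => //.
- by rewrite alpha0.
- exact: ltW.
- by rewrite mulr_ge0// ltW.
- by move=> u _; exact: b_le.
- by move=> u v su uv vt; rewrite /F !idt ?(le_trans su uv) ?(le_trans uv vt)//;
    apply: le_trans (b_lip _ _) _; rewrite -mulrA ler_wpM2l ?(ltW L_gt0)//; exact: xB.
move=> u /andP[su]; rewrite le_eqVlt => /predU1P[->|ut].
  rewrite /V /rfrac_deriv frac_deriv_start ?gt_eqF ?subr_gt0//.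
  by rewrite mulr0 normr0 mulr_ge0 ?powR_ge0.
rewrite /V -(@normc_Zfun _ alpha s t y G u)//.
- by apply: Zlam; rewrite su.
- by rewrite su ltW.
- by move=> v /andP[sv vt]; rewrite /G idt.
Qed.

End horizon.
End solution_path.

(** * The constant and the pathwise bound *)

Section pathwise.
Context {R : realType}.

(** The constant c1 of the short-time estimate; its first summand comes from the
    drift, as t - s <= (t - s)^beta on intervals of length at most 1. *)
Definition base_const (alpha beta K : R) : R :=
  K + `|(Gamma (1 - alpha))^-1| * (K * beta_int (- alpha) (beta + alpha - 1)).

(** The constant c2 in front of the Hoelder constant of the solution; adding 1
    makes it positive, which [increment_le] divides by. *)
Definition feedback_const (alpha beta L : R) : R :=
  `|(Gamma (1 - alpha))^-1| * (L * (alpha * beta_int 0 (beta - (1 + alpha))) *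
    beta_int (beta - alpha) (beta + alpha - 1)) + 1.

Definition increment_const (alpha beta K L : R) : R :=
  2 * base_const alpha beta K + base_const alpha beta K / feedback_const alpha beta L *
    (2 * feedback_const alpha beta L) `^ beta^-1.

Lemma base_const_gt0 alpha beta K : 0 < K -> 0 < base_const alpha beta K.
Proof.
move=> K0; rewrite /base_const ltr_pwDl//.
by rewrite !mulr_ge0 ?beta_int_ge0 ?(ltW K0).
Qed.

Lemma feedback_const_gt0 alpha beta L : 0 <= alpha -> 0 < L ->
  0 < feedback_const alpha beta L.
Proof.
move=> a0 L0; rewrite /feedback_const ltr_wpDl//.
by rewrite !mulr_ge0 ?beta_int_ge0 ?(ltW L0).
Qed.

Lemma Lambda_ub (alpha beta : R) (y : R -> R) t1 t2 lam u v :
  Lambda alpha beta y t1 t2 = lam%:E -> t1 <= u -> u < v -> v <= t2 ->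
  ComplexField.Normc.normc (Zfun alpha y u v) <= lam * (v - u) `^ (beta + alpha - 1).
Proof.
move=> lamE t1u uv vt2.
have uv0 : 0 < v - u by rewrite subr_gt0.
rewrite -ler_pdivrMr ?powR_gt0// -lee_fin -lamE /Lambda le_max; apply/orP; right.
by apply: ereal_sup_ubound; exists u, v.
Qed.

Lemma path_increment_le (H alpha beta K L x0 lam t1 t2 : R) (a b x y : R -> R) :
  2^-1 < H < 1 -> 1 - H < alpha < 2^-1 -> 2^-1 < beta < H ->
  (forall z, `|a z| + `|b z| <= K) ->
  (forall z w, `|a z - a w| + `|b z - b w| <= L * `|z - w|) ->
  holder_below H x -> holder_below H y ->
  (forall t, 0 <= t -> (x t)%:C%C = (x0 + \int[lebesgue_measure]_(s in `[0, t]) a (x s))%:C%C +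
    gls_integral alpha 0 t (fun s => b (x s)) y) ->
  0 < K -> 0 < L -> 0 <= t1 -> t1 < t2 <= t1 + 1 -> 1 <= lam ->
  Lambda alpha beta y t1 t2 = lam%:E ->
  `|x t2 - x t1| <= increment_const alpha beta K L *
     (lam * (t2 - t1) `^ beta + lam `^ beta^-1 * (t2 - t1)).
Proof.
move=> Hr ar br abK abL hx hy eqn K0 L0 t10 /andP[t12 t21] lam1 lamE.
have [al0 al1] : 0 < alpha /\ alpha < 1.
  by case/andP: Hr => ? ?; case/andP: ar => ? ?; split; lra.
have [be0 beH] : 0 < beta /\ beta < H by case/andP: br => ? ?; split; lra.
have lam0 : 0 < lam by exact: lt_le_trans lam1.
have T0 : 0 < t2 by exact: le_lt_trans t12.
have [C xC] : exists C, holder C beta (x \o clamp t2).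
  by apply: holder_clamp => //; apply: hx; rewrite be0.
have C0 := holder_ge0 xC.
apply: (@increment_le _ _ _ _ _ C) => //.
- exact: base_const_gt0.
- by apply: feedback_const_gt0 => //; exact: ltW.
- move=> u v t1u uv vt2; have := xC v u; rewrite /= !clamp_id; last 2 first.
  + by rewrite (le_trans t10)//= (le_trans uv).
  + by rewrite (le_trans t10) ?(le_trans t1u).
  by rewrite [`|v - u|]ger0_norm ?subr_ge0.
move=> s t A t1s st tt2 A0 xA.
have ts0 : 0 < t - s by rewrite subr_gt0.
apply: le_trans (@increment_local _ H alpha beta K L x0 a b x y Hr ar br abK abL hx hy eqn K0 L0
  t2 T0 lam A s t (le_trans t10 t1s) st tt2 (ltW lam0) A0 _ xA) _.
  move=> u /andP[su ut]; apply: (Lambda_ub lamE) => //; exact: le_trans su.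
rewrite /base_const /feedback_const.
set g := `|_|; set B1 := beta_int (- alpha) _; set B2 := beta_int (beta - alpha) _.
set B3 := beta_int 0 _; set p := (t - s) `^ beta; set q := (t - s) `^ (2 * beta).
have p0 : 0 <= p := powR_ge0 _ _; have q0 : 0 <= q := powR_ge0 _ _.
have tsp : t - s <= p.
  apply: ger1_powR; last by lra.
  by rewrite ts0/=; lra.
have le1 : K * (t - s) <= lam * (K * p).
  apply: (@le_trans _ _ (K * p)); first by rewrite ler_wpM2l// ltW.
  by rewrite ler_peMl// mulr_ge0// ltW.
have le2 : 0 <= lam * (A * q) by rewrite !mulr_ge0// ltW.
rewrite -subr_ge0.
rewrite (_ : _ - _ = (lam * (K * p) - K * (t - s)) + lam * (A * q)); last by ring.
by rewrite addr_ge0// subr_ge0.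
Qed.

End pathwise.

Theorem theorem2 (R : realType) (alpha beta K L : R) (K_gt0 : 0 < K)
    (L_gt0 : 0 < L) :
  exists M : R,
  forall (H : R) (H_range : 2^-1 < H < 1)
    (alpha_range : 1 - H < alpha < 2^-1) (beta_range : 2^-1 < beta < H)
    (d : measure_display) (T : measurableType d) (P : probability T R)
    (P_complete : measure_is_complete P)
    (B : R -> {RV P >-> R}) (B_fbm : fractional_brownian_motion H B)
    (delta : R) (delta_range : H^-1 - 1 < delta <= 1)
    (RN : nat -> R) (RN_gt0 : forall N : nat, (1 <= N)%N -> 0 < RN N)
    (a b : R -> R) (coef_ab : coefficients delta K L RN a b)
    (x0 : R) (X : R -> {RV P >-> R})
    (X_solution : sde_solution H alpha a b x0 B X),
  {ae P, forall w, forall t1 t2 : R, 0 <= t1 -> t1 < t2 <= t1 + 1 ->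
    ((`|X t2 w - X t1 w|)%:E <=
     M%:E * (Lambda alpha beta (fun t => B t w) t1 t2 * ((t2 - t1) `^ beta)%:E +
             Lambda alpha beta (fun t => B t w) t1 t2 `^ beta^-1 *
             (t2 - t1)%:E))%E}.
Proof.
exists (increment_const alpha beta K L).
move=> H Hr ar br d T P _ B [_ _ _ B_paths] delta _ RN _ a b [abK abL _ _] x0 X X_solution.
apply: filterS2 B_paths X_solution => w hy [hx eqn] t1 t2 t10 t12.
have beta0 : 0 < beta by case/andP: br => ? _; lra.
have alpha0 : 0 <= alpha by case/andP: Hr => ? ?; case/andP: ar => ? ?; lra.
have M0 : 0 < increment_const alpha beta K L.
  have c1 := base_const_gt0 alpha beta K_gt0.
  have c2 := feedback_const_gt0 beta alpha0 L_gt0.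
  rewrite /increment_const ltr_pwDl// ?mulr_gt0// mulr_ge0 ?powR_ge0//.
  by rewrite divr_ge0// ltW.
have tt0 : 0 < t2 - t1 by case/andP: t12 => ? _; rewrite subr_gt0.
have Lam1 : (1%:E <= Lambda alpha beta (fun t => B t w) t1 t2)%E.
  by rewrite /Lambda le_max lexx.
case E : (Lambda alpha beta (fun t => B t w) t1 t2) Lam1 => [lam| |] //.
  rewrite lee_fin => lam1; rewrite poweR_EFin -(EFinM lam) -(EFinM (lam `^ beta^-1)).
  rewrite -(EFinD (lam * _)) -(EFinM (increment_const _ _ _ _)) lee_fin.
  apply: (@path_increment_le R H alpha beta K L x0 lam t1 t2 a b
    (fun t => X t w) (fun t => B t w)) => //.
  by move=> t t0; have [] := eqn t t0.
(* an infinite Lambda makes the right-hand side infinite *)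
move=> _; rewrite poweRyr ?gt_eqF ?invr_gt0//.
by rewrite !gt0_mulye ?lte_fin ?powR_gt0//= gt0_muley ?lte_fin// leey.
Qed.
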